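(* Let $M$ be a $d\times d$ dilation matrix, $m=|\det M|$, and let $t\in\mathcal{Z}^1$. Then there exist trigonometric matrices $T$ and $Q$ of orders $d\times d$ and $d^2\times d^2$, respectively, satisfying $$\triangledown S_t(f)=S_T(\triangledown f)\quad\forall f\in\ell_\infty,\qquad \triangledown S_T(f)=S_Q(\triangledown f)\quad\forall f\in\ell_\infty^d .$$ Moreover, if $t(\mathbf{0})=m$ and such $T,Q$ satisfy $$\|{M^*}^L\|_\infty\,\|S_Q^L\|_\infty\le\mu<1$$ for some positive integer $L$, then the subdivision scheme $S_T$ normalized by $M$ uniformly converges on $\triangledown\ell_\infty$.
   Context: A dilation matrix $M$ is a non-degenerate $d\times d$ integer matrix all of whose eigenvalues are larger than $1$ in modulus; $M^*$ is its transpose. A trigonometric polynomial is a function $t(x)=\sum_{n\in\mathbb{Z}^d}\widehat t(n)e^{2\pi i(n,x)}$ with finitely many non-zero coefficients. $D(M^* )$ is a set of representatives of the cosets $\mathbb{Z}^d/M^*\mathbb{Z}^d$ containing $\mathbf{0}$. $\mathcal{Z}^1$ is the set of trigonometric polynomials $t$ such that $D^\beta\big[t({M^*}^{-1}x)\big]\big|_{x=s}=0$ for all $s\in D(M^* )$, $s\ne\mathbf{0}$, and all $\beta\in\mathbb{Z}_+^d$ with $\beta_1+\dots+\beta_d\le1$. $\ell_\infty^N$ is the space of bounded sequences $f=\{f_\alpha\}_{\alpha\in\mathbb{Z}^d}$ with $f_\alpha\in\mathbb{R}^N$, normed by $\|f\|_\infty=\sup_\alpha|f_\alpha|$, where $|x|=\max_j|x_j|$;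 $\ell_\infty=\ell_\infty^1$. An $N\times N$ trigonometric matrix is $T(x)=\sum_{\alpha\in\mathbb{Z}^d}A_\alpha e^{-2\pi i(\alpha,x)}$, with $A_\alpha$ real $N\times N$ matrices, only finitely many non-zero (for $N=1$ this is a trigonometric polynomial $t$). The subdivision operator $S_T=S_{T,M}$ on $\ell_\infty^N$ is $(S_Tf)_\alpha=\sum_{\beta\in\mathbb{Z}^d}A_{\alpha-M\beta}f_\beta$, and $\{S_T^k\}_{k\ge1}$ is the subdivision scheme $S_T$. $\|\cdot\|_\infty$ of an operator or matrix is the operator norm induced by the sup norms above. For $f\in\ell_\infty$, $\triangledown f\in\ell_\infty^d$ is $(\triangledown f)_\alpha=(f_\alpha-f_{\alpha-\mathbf{e}_1},\dots,f_\alpha-f_{\alpha-\mathbf{e}_d})^T$. For $f\in\ell_\infty^N$ with component sequences $f^{(1)},\dots,f^{(N)}\in\ell_\infty$, $\triangledown f\in\ell_\infty^{Nd}$ is $(\triangledown f)_\alpha=\big((\triangledown f^{(1)})_\alpha^T,\dots,(\triangledown f^{(N)})_\alpha^T\big)^T$. $\triangledown\ell_\infty=\{\triangledown f:f\in\ell_\infty\}$. The $d\times d$ scheme $S_T$ normalized by $M$ is the sequence $\{{M^*}^kS_T^k\}_{k\ge1}$, where ${M^*}^k$ acts on each term of a sequence. It is uniformly convergent on a subspace $V\subseteq\ell_\infty^d$, $V\ne\{0\}$, if for every $F\in V$ there is a continuous function $S^\infty_{T/M}F:\mathbb{R}^d\to\mathbb{R}^d$ with $$\lim_{k\to\infty}\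 \sup_{\alpha\in\mathbb{Z}^d}\big|({M^*}^kS_T^kF)_\alpha-(S^\infty_{T/M}F)(M^{-k}\alpha)\big|=0,$$ and for at least one $F\in V$ the limit $S^\infty_{T/M}F$ is not identically zero. *)

(* Defs.v *)
(* MathComp / MathComp-Analysis, over an arbitrary [R : realType]. *)
From HB Require Import structures.
From mathcomp Require Import all_boot all_order all_algebra.
From mathcomp Require Import finmap complex.
From mathcomp Require Import all_classical all_reals all_analysis.
Set Implicit Arguments.
Unset Strict Implicit.
Unset Printing Implicit Defensive.
Import Order.TTheory GRing.Theory Num.Theory.
Import numFieldNormedType.Exports.
Local Open Scope classical_set_scope.
Local Open Scope ring_scope.

Section Scheme.
Variables (R : realType) (d : nat).

Definition mxR m n (A : 'M[int]_(m, n)) : 'M[R]_(m, n) := map_mx intr A.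

(* The eigenvalues are the complex ones. *)
Definition dilation (M : 'M[int]_d) : Prop :=
  \det M != 0 /\
  forall z : R[i], eigenvalue (map_mx intr M : 'M[R[i]]_d) z -> 1 < `|z|.

Definition coset_reps (A : 'M[int]_d) (D : set 'cV[int]_d) : Prop :=
  D 0 /\ forall n, exists! s, D s /\ exists k, n = s + A *m k.

(* Trigonometric polynomials with real coefficients and N x N trigonometric
   matrices are given by their finitely supported coefficients, the coefficient
   at [a] being that of [exp (- 2 pi i (a, x))]. *)
Definition trigpoly := {fsfun 'cV[int]_d -> R with 0}.
Definition trigmx (N : nat) := {fsfun 'cV[int]_d -> 'M[R]_N with 0}.

Definition dotv (a : 'cV[int]_d) (x : 'cV[R]_d) : R :=
  \sum_(j < d) (a j 0)%:~R * x j 0.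

Definition expi (u : R) : R[i] := (cos u +i* sin u)%C.

Definition trigpoly_eval (t : trigpoly) (x : 'cV[R]_d) : R[i] :=
  \sum_(a <- finsupp t) (t a)%:C%C * expi (- (2 * pi * dotv a x)).

(* [R[i]] is not a normed space over [R] in the library: real and imaginary
   parts are differentiated separately. *)
Definition partial_deriv (j : 'I_d) (f : 'cV[R]_d -> R[i]) (x : 'cV[R]_d) :
    R[i] :=
  ('D_(delta_mx j 0) (fun y => complex.Re (f y)) x
     +i* 'D_(delta_mx j 0) (fun y => complex.Im (f y)) x)%C.

Definition multi_deriv (b : 'I_d -> nat) (f : 'cV[R]_d -> R[i]) :
    'cV[R]_d -> R[i] :=
  foldr (fun j g => iter (b j) (partial_deriv j) g) f (enum 'I_d).

(* The class Z^r; [D] stands for the digit set D(M^T). *)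
Definition in_Z (r : nat) (M : 'M[int]_d) (D : set 'cV[int]_d)
    (t : trigpoly) : Prop :=
  forall s, D s -> s != 0 ->
  forall b : 'I_d -> nat, (\sum_(j < d) b j <= r)%N ->
  multi_deriv b (fun x => trigpoly_eval t (invmx (mxR M^T) *m x))
    (mxR s) = 0.

(* The norm of the library on ['cV[R]_N] is the maximum norm. The value is
   [+oo] exactly when [f] is unbounded. *)
Definition linf_norm N (f : 'cV[int]_d -> 'cV[R]_N) : \bar R :=
  ereal_sup [set `|f a|%:E | a in [set: 'cV[int]_d]].

Definition linf_opnorm N N'
    (S : ('cV[int]_d -> 'cV[R]_N) -> ('cV[int]_d -> 'cV[R]_N')) : \bar R :=
  ereal_sup [set linf_norm (S f) | f in [set f | (linf_norm f <= 1)%E]].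

Definition mx_opnorm N (A : 'M[R]_N) : \bar R :=
  ereal_sup [set `|A *m x|%:E | x in [set x : 'cV[R]_N | `|x| <= 1]].

(* Sums over all of Z^d: for [\det M != 0] only finitely many terms are
   non-zero. *)
Definition subdiv1 (M : 'M[int]_d) (t : trigpoly) (f : 'cV[int]_d -> R) :
    'cV[int]_d -> R :=
  fun a => \sum_(b \in [set: 'cV[int]_d]) t (a - M *m b) * f b.

Definition subdiv N (M : 'M[int]_d) (T : trigmx N)
    (f : 'cV[int]_d -> 'cV[R]_N) : 'cV[int]_d -> 'cV[R]_N :=
  fun a => \sum_(b \in [set: 'cV[int]_d]) T (a - M *m b) *m f b.

Definition nabla1 (f : 'cV[int]_d -> R) : 'cV[int]_d -> 'cV[R]_d :=
  fun a => \col_(j < d) (f a - f (a - delta_mx j 0)).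

(* [mxvec] lists the rows one after the other. *)
Definition nabla N (f : 'cV[int]_d -> 'cV[R]_N) :
    'cV[int]_d -> 'cV[R]_(N * d) :=
  fun a => (mxvec (\matrix_(i < N) (nabla1 (fun c => f c i 0) a)^T))^T.

Definition nabla_linf : set ('cV[int]_d -> 'cV[R]_d) :=
  [set nabla1 f | f in [set f : 'cV[int]_d -> R | bounded_fun f]].

Definition nabla_intertwined (M : 'M[int]_d) (t : trigpoly) (T : trigmx d)
    (Q : trigmx (d * d)) : Prop :=
  (forall f : 'cV[int]_d -> R, bounded_fun f ->
     nabla1 (subdiv1 M t f) = subdiv M T (nabla1 f)) /\
  (forall f : 'cV[int]_d -> 'cV[R]_d, bounded_fun f ->
     nabla (subdiv M T f) = subdiv M Q (nabla f)).

Definition linf_subspace N (V : set ('cV[int]_d -> 'cV[R]_N)) : Prop :=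
  [/\ V `<=` [set F | bounded_fun F],
      V 0 &
      forall (c : R) F G, V F -> V G -> V (c *: F + G)].

Definition normalized_limit (M : 'M[int]_d) (T : trigmx d)
    (F : 'cV[int]_d -> 'cV[R]_d) (g : 'cV[R]_d -> 'cV[R]_d) : Prop :=
  continuous g /\
  linf_norm (fun a => (mxR M^T) ^+ k *m iter k (subdiv M T) F a
                        - g (invmx (mxR M) ^+ k *m mxR a))
    @[k --> \oo] --> 0%E.

Definition normalized_uniformly_converges (M : 'M[int]_d) (T : trigmx d)
    (V : set ('cV[int]_d -> 'cV[R]_d)) : Prop :=
  [/\ linf_subspace V,
      V <> [set 0],
      (forall F, V F -> exists g, normalized_limit M T F g) &
      exists F g, [/\ V F, normalized_limit M T F g & exists x, g x != 0]].

End Scheme.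

(* Main.v *)
Require Import Defs.
From HB Require Import structures.
From mathcomp Require Import all_boot all_order all_algebra.
From mathcomp Require Import finmap complex.
From mathcomp Require Import all_classical all_reals all_analysis.
From mathcomp Require Import ring lra.
Set Implicit Arguments.
Unset Strict Implicit.
Unset Printing Implicit Defensive.
Import Order.TTheory GRing.Theory Num.Theory.
Import numFieldNormedType.Exports.
Local Open Scope classical_set_scope.
Local Open Scope ring_scope.

(** Write [A] for [M] over the reals and [A^T] for its transpose.

    Existence of [T] and [Q]. By Fourier inversion on the finite group
    Z^d / M Z^d, the zeros of [t] prescribed by the class Z^1 say that the
    sums of [t n] and of [t n * (M^-1 n)_j] over a coset of M Z^d do not
    depend on the coset ([in_Z_sum_rule0], [in_Z_sum_rule1]). If the
    coefficients of a scalar scheme sum to zero over every coset, each of them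
    can be moved inside its coset, at the price of differences of the
    argument, until they cancel; so the scheme factors through the differences
    of its argument ([factors_subdiv1]). The differences of the sequences
    produced by the scheme of [t] come from such a scheme, which gives [T].
    The second sum rule makes every intertwining [T] map the constant sequence
    [v] to the constant sequence [c A^-T v], because the scheme of [t] maps
    linear functions to linear functions plus constants ([subdiv_cst]). Hence
    the entries of [T] satisfy the first sum rule in their turn, which
    gives [Q].

    Convergence. If [t 0 = |det M|] then [c = 1], as there are |det M| cosets
    ([sum_coefs_cosets]), and [A^T S_T] reproduces constants. The iterates
    [G_k = (A^T)^k S_T^k F] then satisfy two estimates in terms of
    [e_k = |(A^T)^k| |nabla S_T^k F|]: values of [G_k] at neighbouring points
    are within [O(e_k)] of each other, and [G_(k+1) a] is within [O(e_k)] of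
    the values of [G_k] near [M^-1 a]. As [nabla S_T^k = S_Q^k nabla], the
    hypothesis gives [e_(k+L) <= mu e_k], so [e_k] decays geometrically. Thus
    [g x = lim G_k (floor (A^k x))] exists with a uniform geometric error
    ([limit_function]), and the two estimates make it continuous.

    Nonzero limit. As [M] is expanding, [S_T^k F] on a suitable bounded set
    containing 0 depends, for every [k], only on the values of [F] on that set.
    For [f] linear with gradient [v] on a large ball and 0 outside it,
    [S_T^k (nabla f)] is therefore [(A^T)^-k v] at 0, whence [g 0 = v]. That
    the powers of [M^-1] decay follows from the eigenvalues by the
    Cayley-Hamilton theorem ([dilation_inverse_decay]). *)

(** * Subdivision as an upsampled convolution *)

Section Upsampling.
Variables (d : nat) (M : 'M[int]_d).

(** The solution [b] of [u = M b], if any: with it, a sum over all of Z^d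
    of terms [t (a - M b) f b] becomes a sum over the support of [t], to
    which the usual big operator lemmas apply. *)
Definition lattice_coord (u : 'cV[int]_d) : option 'cV[int]_d :=
  let b := xget 0 [set b | u = M *m b] in
  if u == M *m b then Some b else None.

Definition upsample (V : nmodType) (f : 'cV[int]_d -> V) (u : 'cV[int]_d) : V :=
  oapp f 0 (lattice_coord u).

Hypothesis M_neq0 : \det M != 0.

Lemma mulmx_int_inj n : injective (fun b : 'M[int]_(d, n) => M *m b).
Proof.
move=> b c /= /(congr1 (mulmx (\adj M))); rewrite !mulmxA mul_adj_mx.
rewrite !mul_scalar_mx => /matrixP e; apply/matrixP => i j.
by have := e i j; rewrite !mxE; apply: mulfI.
Qed.

Lemma lattice_coord_mul b : lattice_coord (M *m b) = Some b.
Proof.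
rewrite /lattice_coord; case: xgetP => [c _ /= ec|/(_ b)/= /(_ erefl)//].
by rewrite ec eqxx (mulmx_int_inj ec).
Qed.

Lemma lattice_coordP u b : lattice_coord u = Some b <-> u = M *m b.
Proof.
split=> [|->]; last exact: lattice_coord_mul.
by rewrite /lattice_coord; case: eqP => // e [<-].
Qed.

Lemma lattice_coordD u k :
  lattice_coord (u + M *m k) = omap (+%R^~ k) (lattice_coord u).
Proof.
case e: (lattice_coord u) => [b|] /=.
  by move/lattice_coordP : e => ->; rewrite -mulmxDr lattice_coord_mul.
case e' : (lattice_coord _) => [c|] //; move/lattice_coordP : e' => e'.
suff : lattice_coord u = Some (c - k) by rewrite e.
by apply/lattice_coordP; rewrite mulmxBr -e' addrK.
Qed.

Lemma upsample_mul (V : nmodType) (f : 'cV[int]_d -> V) b :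
  upsample f (M *m b) = f b.
Proof. by rewrite /upsample lattice_coord_mul. Qed.

Lemma upsample_shift (V : nmodType) (f : 'cV[int]_d -> V) u k :
  upsample f (u + M *m k) = upsample (fun b => f (b + k)) u.
Proof. by rewrite /upsample lattice_coordD; case: (lattice_coord u). Qed.

Lemma fsum_lattice (V : zmodType) (s : {fset 'cV[int]_d})
    (phi : 'cV[int]_d -> 'cV[int]_d -> V) a :
  (forall n b, n \notin s -> phi n b = 0) ->
  \sum_(b \in [set: 'cV[int]_d]) phi (a - M *m b) b =
  \sum_(n <- s) upsample (phi n) (a - n).
Proof.
move=> phi0.
pose P := [set n | n \in s /\ exists b, a - n = M *m b].
rewrite -(@fsbig_fwiden _ _ _ _ s P); first last.
- move=> n [/= ns nP]; rewrite /upsample.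
  case e : (lattice_coord _) => [b|] //=; move/lattice_coordP : e => e.
  by exfalso; apply: nP; split=> //; exists b.
- exact: fset_uniq.
- by move=> n [].
pose Q := [set b | a - M *m b \in s].
rewrite -(@fsbig_widen _ _ _ _ Q) //; last first.
  by move=> b [_ /= /negP bQ]; apply: phi0.
rewrite [RHS](@reindex_fsbig _ _ _ _ _ (fun b => a - M *m b) Q); last first.
  split.
  - by move=> b bQ; split=> //; exists b; rewrite subKr.
  - by move=> b c _ _ /addrI /oppr_inj /mulmx_int_inj.
  - by move=> n [ns [b e]]; exists b; rewrite ?/Q /= -e subKr //.
by apply: eq_fsbigr => b _; rewrite subKr upsample_mul.
Qed.

Lemma subdiv1_fset (R : realType) (t : trigpoly R d) (s : {fset 'cV[int]_d}) f a :
  (forall n, n \notin s -> t n = 0) ->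
  subdiv1 M t f a = \sum_(n <- s) t n * upsample f (a - n).
Proof.
move=> t0; rewrite /subdiv1.
rewrite (@fsum_lattice _ s (fun n b => t n * f b)); last first.
  by move=> n b /t0 ->; rewrite mul0r.
apply: eq_bigr => n _; rewrite /upsample.
by case: lattice_coord => //=; rewrite mulr0.
Qed.

Lemma subdiv1E (R : realType) (t : trigpoly R d) f a :
  subdiv1 M t f a = \sum_(n <- finsupp t) t n * upsample f (a - n).
Proof. by apply: subdiv1_fset => n; apply: fsfun_dflt. Qed.

Lemma subdivE (R : realType) N (T : trigmx R d N) F a :
  subdiv M T F a = \sum_(n <- finsupp T) T n *m upsample F (a - n).
Proof.
rewrite /subdiv (@fsum_lattice _ (finsupp T) (fun n b => T n *m F b)).
  apply: eq_bigr => n _; rewrite /upsample.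
  by case: lattice_coord => //=; rewrite mulmx0.
by move=> n b /fsfun_dflt ->; rewrite mul0mx.
Qed.

Definition trigmx_entry (R : realType) N (T : trigmx R d N) i j : trigpoly R d :=
  [fsfun n in finsupp T => T n i j].

Lemma trigmx_entryE (R : realType) N (T : trigmx R d N) i j n :
  trigmx_entry T i j n = T n i j.
Proof.
rewrite fsfunE; case: ifPn => // /fsfun_dflt ->.
by rewrite mxE.
Qed.

(** Reduces schemes with matrix coefficients to scalar ones. *)
Lemma subdiv_coord (R : realType) N (T : trigmx R d N) F a i :
  subdiv M T F a i 0 =
  \sum_j subdiv1 M (trigmx_entry T i j) (fun b => F b j 0) a.
Proof.
rewrite subdivE summxE.
under [RHS]eq_bigr => j _.
  rewrite (@subdiv1_fset _ _ (finsupp T)); last first.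
    by move=> n; rewrite trigmx_entryE => /fsfun_dflt ->; rewrite mxE.
  over.
rewrite exchange_big; apply: eq_bigr => n _; rewrite mxE.
apply: eq_bigr => j _; rewrite trigmx_entryE /upsample.
by case: lattice_coord => //=; rewrite mxE.
Qed.

Lemma trigmx_of_entries (R : realType) N (q : 'I_N -> 'I_N -> trigpoly R d) :
  exists T : trigmx R d N, forall i j, trigmx_entry T i j = q i j.
Proof.
pose s := [fset n in flatten [seq enum_fset (finsupp (q p.1 p.2)) |
  p <- enum {: 'I_N * 'I_N}]]%fset.
exists [fsfun n in s => \matrix_(i, j) q i j n] => i j; apply/fsfunP => n.
rewrite trigmx_entryE fsfunE; case: ifPn => [_|]; rewrite mxE//.
rewrite /s inE /=; apply: contraNeq => qn.
apply/flattenP; exists (enum_fset (finsupp (q i j))).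
  by apply/mapP; exists (i, j); rewrite ?mem_enum.
by change (n \in finsupp (q i j)); rewrite mem_finsupp eq_sym.
Qed.

End Upsampling.

(** * Factoring differences through a scheme *)

Section Factorization.
Variables (R : realType) (d : nat) (M : 'M[int]_d).
Hypothesis M_neq0 : \det M != 0.

Local Notation e_ l := (delta_mx l 0 : 'cV[int]_d).

Definition trigpoly_comb (t1 t2 : trigpoly R d) (c : R) : trigpoly R d :=
  [fsfun n in (finsupp t1 `|` finsupp t2)%fset => t1 n + c * t2 n].

Lemma trigpoly_combE t1 t2 c n : trigpoly_comb t1 t2 c n = t1 n + c * t2 n.
Proof.
rewrite fsfunE in_fsetU; case: ifPn => //; rewrite negb_or => /andP[n1 n2].
by rewrite (fsfun_dflt n1) (fsfun_dflt n2) mulr0 addr0.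
Qed.

Lemma subdiv1_comb t1 t2 c f a : subdiv1 M (trigpoly_comb t1 t2 c) f a =
  subdiv1 M t1 f a + c * subdiv1 M t2 f a.
Proof.
pose s := (finsupp t1 `|` finsupp t2)%fset.
have s1 n : n \notin s -> t1 n = 0.
  by rewrite in_fsetU negb_or => /andP[/fsfun_dflt].
have s2 n : n \notin s -> t2 n = 0.
  by rewrite in_fsetU negb_or => /andP[_ /fsfun_dflt].
rewrite !(@subdiv1_fset _ _ M_neq0 _ _ s) //; last first.
  by move=> n ns; rewrite trigpoly_combE s1 // s2 // mulr0 addr0.
rewrite mulr_sumr -big_split; apply: eq_bigr => n _ /=.
by rewrite trigpoly_combE mulrDl mulrA.
Qed.

Definition trigpoly_shift (t : trigpoly R d) (k : 'cV[int]_d) : trigpoly R d :=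
  [fsfun n in [fset (m + k)%R | m in finsupp t]%fset => t (n - k)].

Lemma trigpoly_shiftE t k n : trigpoly_shift t k n = t (n - k).
Proof.
rewrite fsfunE; case: ifPn => // /imfsetP nt; apply/esym/fsfun_dflt.
by apply/negP => nk; apply: nt; exists (n - k) => //=; rewrite subrK.
Qed.

Lemma subdiv1_trigpoly_shift t k f a :
  subdiv1 M (trigpoly_shift t k) f a = subdiv1 M t f (a - k).
Proof.
by apply: eq_fsbigr => b _; rewrite trigpoly_shiftE addrAC.
Qed.

(** Scalar form of both intertwining relations: [q] is one row of the matrix
    scheme that acts on the differences. *)
Definition factors (Lam : ('cV[int]_d -> R) -> 'cV[int]_d -> R) : Prop :=
  exists q : 'I_d -> trigpoly R d, forall f a,
    Lam f a = \sum_l subdiv1 M (q l) (fun b => f b - f (b - e_ l)) a.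

Lemma factors_ext Lam Lam' : (forall f a, Lam f a = Lam' f a) ->
  factors Lam -> factors Lam'.
Proof. by move=> e [q qE]; exists q => f a; rewrite -e qE. Qed.

Lemma subdiv1_0 f a : subdiv1 M ([fsfun] : trigpoly R d) f a = 0.
Proof.
rewrite (@subdiv1_fset _ _ M_neq0 _ _ fset0) ?big_nil // => n _.
by rewrite fsfunE.
Qed.

Lemma factors0 : factors (fun _ _ => 0).
Proof.
exists (fun=> [fsfun]) => f a; rewrite big1 // => l _; exact: subdiv1_0.
Qed.

Lemma factors_comb L1 L2 c : factors L1 -> factors L2 ->
  factors (fun f a => L1 f a + c * L2 f a).
Proof.
move=> [q1 q1E] [q2 q2E]; exists (fun l => trigpoly_comb (q1 l) (q2 l) c) => f a.
rewrite q1E q2E mulr_sumr -big_split; apply: eq_bigr => l _.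
by rewrite subdiv1_comb.
Qed.

Lemma factors_sum (I : eqType) (s : seq I) (c : I -> R) Lam :
  (forall i, factors (Lam i)) ->
  factors (fun f a => \sum_(i <- s) c i * Lam i f a).
Proof.
move=> LamP; elim: s => [|i s IHs].
  by apply: factors_ext factors0 => f a; rewrite big_nil.
apply: factors_ext (factors_comb (c i) IHs (LamP i)) => f a.
by rewrite big_cons addrC.
Qed.

Lemma factors_unit_shift l n :
  factors (fun f a => upsample M f (a - n + M *m (- e_ l)) -
                      upsample M f (a - n)).
Proof.
pose dn : trigpoly R d := [fsfun m in [fset n]%fset => (-1 : R)].
exists (fun l' => if l' == l then dn else [fsfun]) => f a.
rewrite (bigD1 l) //= eqxx big1 ?addr0; last first.
  by move=> l' /negPf ->; rewrite subdiv1_0.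
rewrite (@subdiv1_fset _ _ M_neq0 _ _ [fset n]%fset); last first.
  by move=> m /negPf mn; rewrite fsfunE mn.
rewrite big_seq_fset1 fsfunE inE eqxx upsample_shift // /upsample.
by case: lattice_coord => [b|] /=; ring.
Qed.

Lemma intcol_sum (k : 'cV[int]_d) : k = \sum_l e_ l *~ k l 0.
Proof.
rewrite [LHS]matrix_sum_delta; apply: eq_bigr => l _.
by rewrite big_ord1 -scaler_int intz.
Qed.

(** The shifts whose difference with the identity factors form a subgroup of
    Z^d, and the unit vectors belong to it. *)
Lemma factors_shift k n :
  factors (fun f a => upsample M f (a - n + M *m k) - upsample M f (a - n)).
Proof.
pose P k := forall n, factors (fun f a =>
  upsample M f (a - n + M *m k) - upsample M f (a - n)).
have PD k1 k2 : P k1 -> P k2 -> P (k1 + k2).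
  move=> P1 P2 m; apply: factors_ext (factors_comb 1 (P1 m) (P2 (m - M *m k1))).
  move=> f a; have -> : a - (m - M *m k1) = a - m + M *m k1.
    by rewrite opprB addrA addrAC.
  by rewrite mulmxDr addrA; ring.
have PN k1 : P k1 -> P (- k1).
  move=> P1 m.
  apply: factors_ext (factors_comb (-1) factors0 (P1 (m + M *m k1))).
  by move=> f a; rewrite opprD addrA subrK mulmxN; ring.
have P0 : P 0.
  by move=> m; apply: factors_ext factors0 => f a; rewrite mulmx0 addr0 subrr.
have Pn l j : P (e_ l *+ j).
  elim: j => [|j Pj]; first by rewrite mulr0n.
  rewrite mulrS; apply: PD => //; rewrite -[e_ l]opprK.
  by apply: PN => m; apply: factors_unit_shift.
suff: P k by apply.
rewrite (intcol_sum k); apply: big_ind => // l _.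
case: (k l 0) => j; first exact: Pn.
by rewrite NegzE mulrNz; apply: PN; apply: Pn.
Qed.

Definition coset_rep (n : 'cV[int]_d) : 'cV[int]_d :=
  xget 0 [set r | exists k, n = r + M *m k].

Lemma coset_rep_eq n : exists k, n = coset_rep n + M *m k.
Proof.
rewrite /coset_rep; case: xgetP => [r _ //|/(_ n) []].
by exists 0; rewrite mulmx0 addr0.
Qed.

Lemma coset_rep_shift n b : coset_rep (n + M *m b) = coset_rep n.
Proof.
congr xget; apply/seteqP; split=> r [k e].
  by exists (k - b); rewrite mulmxBr addrA -e addrK.
by exists (k + b); rewrite mulmxDr addrA -e.
Qed.

(** Modulo differences, every coefficient can be moved to the representative
    of its coset, where the coefficients of a coset cancel. *)
Lemma factors_subdiv1 (t : trigpoly R d) :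
  (forall a, subdiv1 M t (fun=> 1) a = 0) -> factors (subdiv1 M t).
Proof.
move=> t0.
have LamP n : factors (fun f a =>
    upsample M f (a - n) - upsample M f (a - coset_rep n)).
  have [k nk] := coset_rep_eq n.
  apply: factors_ext (factors_shift (- k) (coset_rep n)) => f a.
  suff -> : a - n = a - coset_rep n + M *m (- k) by [].
  by rewrite {1}nk opprD mulmxN addrA.
apply: factors_ext (factors_sum (finsupp t) t LamP) => f a.
rewrite subdiv1E //; under eq_bigr do rewrite mulrBr.
rewrite big_split sumrN /=.
suff -> : \sum_(n <- finsupp t) t n * upsample M f (a - coset_rep n) =
    upsample M f (a - coset_rep a) * subdiv1 M t (fun=> 1) a.
  by rewrite t0 mulr0 subr0.
rewrite subdiv1E // mulr_sumr; apply: eq_bigr => n _.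
rewrite mulrCA; congr (_ * _).
case e : (lattice_coord M (a - n)) => [b|].
  rewrite {3}/upsample e mulr1; move/lattice_coordP : e => /(_ M_neq0) e.
  by congr (upsample _ _ (_ - _)); rewrite -[a](subrK n) e addrC coset_rep_shift.
rewrite {3}/upsample e mulr0 /upsample.
have [k nk] := coset_rep_eq n.
have -> : a - coset_rep n = a - n + M *m k.
  by rewrite {2}nk opprD addrA subrK.
by rewrite lattice_coordD // e.
Qed.

(** Subtracting a shift turns coset sums that are all equal into coset sums
    that all vanish. *)
Lemma factors_difference (t : trigpoly R d) c j :
  (forall a, subdiv1 M t (fun=> 1) a = c) ->
  factors (fun f a => subdiv1 M t f a - subdiv1 M t f (a - e_ j)).
Proof.
move=> tc; pose p := trigpoly_comb t (trigpoly_shift t (e_ j)) (-1).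
have pE f a : subdiv1 M p f a = subdiv1 M t f a - subdiv1 M t f (a - e_ j).
  by rewrite subdiv1_comb subdiv1_trigpoly_shift mulN1r.
apply: (factors_ext pE); apply: factors_subdiv1 => a.
by rewrite pE !tc subrr.
Qed.

Lemma nabla1_factor (t : trigpoly R d) c :
  (forall a, subdiv1 M t (fun=> 1) a = c) ->
  exists T : trigmx R d d, forall f,
    nabla1 (subdiv1 M t f) = subdiv M T (nabla1 f).
Proof.
move=> tc; have /boolp.choice[q qE] := fun j => factors_difference j tc.
have [T TE] := trigmx_of_entries q; exists T => f.
apply/funext => a; apply/matrixP => j o; rewrite ord1 subdiv_coord // mxE qE.
apply: eq_bigr => l _; rewrite TE; congr (subdiv1 _ _ _ _).
by apply/funext => b; rewrite mxE.
Qed.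

Lemma nablaE N (F : 'cV[int]_d -> 'cV[R]_N) a i j :
  nabla F a (mxvec_index i j) 0 = F a i 0 - F (a - e_ j) i 0.
Proof. by rewrite mxE mxvecE !mxE. Qed.

Lemma nabla_factor N (T : trigmx R d N) (c : 'I_N -> 'I_N -> R) :
  (forall i k a, subdiv1 M (trigmx_entry T i k) (fun=> 1) a = c i k) ->
  exists Q : trigmx R d (N * d), forall F,
    nabla (subdiv M T F) = subdiv M Q (nabla F).
Proof.
move=> Tc.
have /boolp.choice[q qE] := fun ijk : 'I_N * 'I_d * 'I_N =>
  factors_difference ijk.1.2 (Tc ijk.1.1 ijk.2).
have [g gK Kg] := curry_mxvec_bij N d.
have [Q QE] := trigmx_of_entries (fun r s => q (g r, (g s).1) (g s).2).
exists Q => F; apply/funext => a; apply/matrixP => r o; rewrite ord1.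
rewrite subdiv_coord //; case/mxvec_indexP: r => i j.
rewrite nablaE !subdiv_coord // -sumrB.
under eq_bigr => k _ do rewrite (qE (i, j, k)).
rewrite pair_bigA (reindex _ (curry_mxvec_bij N d)) /=.
apply: eq_big => [[k l]//|[k l] _] /=; rewrite QE.
have gE x y : g (mxvec_index x y) = (x, y) by rewrite (gK (x, y)).
rewrite !gE; congr (subdiv1 _ _ _ _).
by apply/funext => b; rewrite nablaE.
Qed.

End Factorization.

(** * Sum rules *)

Section DirectionalDerivative.
Variables (R : realType) (d : nat).

Lemma derive_line (f : 'cV[R]_d -> R) v x :
  'D_v f x = 'D_1 (fun h : R => f (h *: v + x)) 0.
Proof.
rewrite /derive; set g := (X in lim (X @ _)); set g' := (X in _ = lim (X @ _)).
suff -> : g = g' by [].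
rewrite funeqE => h; rewrite /g /g' /=.
by rewrite scale0r add0r addr0 [h *: 1]mulr1.
Qed.

Lemma derive_sum_comp (I : Type) (s : seq I) (c : I -> R)
    (l : I -> 'cV[R]_d -> R) (G dG : R -> R) v x :
  (forall u, is_derive (u : R) (1 : R) G (dG u)) ->
  (forall i h, l i (h *: v + x) = h * l i v + l i x) ->
  'D_v (fun y => \sum_(i <- s) c i * G (l i y)) x =
  \sum_(i <- s) c i * (l i v * dG (l i x)).
Proof.
move=> GP lin; rewrite derive_line.
under eq_fun do under eq_bigr do rewrite lin.
suff /@derive_val : is_derive (0 : R) (1 : R)
    (fun h => \sum_(i <- s) c i * G (h * l i v + l i x))
    (\sum_(i <- s) c i * (l i v * dG (l i x))) by [].
elim: s => [|i s IHs].
  rewrite big_nil; under eq_fun do rewrite big_nil.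
  exact: is_derive_cst.
rewrite big_cons; under eq_fun do rewrite big_cons.
apply: is_deriveD => //.
have GP' := GP (0 * l i v + l i x).
have lP : is_derive (0 : R) (1 : R) (fun h => h * l i v + l i x) (l i v).
  have := is_deriveD (is_deriveM (is_derive_id (0 : R) (1 : R))
      (is_derive_cst (l i v) (0 : R) (1 : R)))
      (is_derive_cst (l i x) (0 : R) (1 : R)).
  by rewrite scale0r add0r addr0 [_ *: _]mulr1.
have := is_deriveM (is_derive_cst (c i) (0 : R) (1 : R))
    (@is_derive1_comp R G (fun h : R => h * l i v + l i x) 0 _ _ GP' lP).
by rewrite scaler0 addr0 mul0r add0r [dG _ * _]mulrC.
Qed.

Lemma dotvE (a : 'cV[int]_d) (x : 'cV[R]_d) : dotv a x = ((mxR R a)^T *m x) 0 0.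
Proof. by rewrite mxE; apply: eq_bigr => j _; rewrite !mxE. Qed.

Lemma dotv_linear (a : 'cV[int]_d) h (v x : 'cV[R]_d) :
  dotv a (h *: v + x) = h * dotv a v + dotv a x.
Proof. by rewrite !dotvE mulmxDr -scalemxAr !mxE. Qed.

Lemma multi_deriv0 (f : 'cV[R]_d -> R[i]) : multi_deriv (fun=> 0%N) f = f.
Proof. by rewrite /multi_deriv; elim: (enum _). Qed.

Lemma multi_deriv1 j (f : 'cV[R]_d -> R[i]) :
  multi_deriv (fun i => i == j : nat) f = partial_deriv j f.
Proof.
rewrite /multi_deriv.
suff: forall s, uniq s -> foldr (fun i g => iter (i == j) (partial_deriv i) g)
    f s = if j \in s then partial_deriv j f else f.
  by move=> /(_ _ (enum_uniq _)) ->; rewrite mem_enum.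
elim=> [//|i s IHs] /= /andP[si /IHs ->]; rewrite inE eq_sym.
by case: eqP si => [<- /negPf ->|].
Qed.

Lemma Re_realM (x : R) (z : R[i]) : complex.Re (x%:C%C * z) = x * complex.Re z.
Proof. by case: z => a b /=; rewrite mul0r subr0. Qed.

Lemma Im_realM (x : R) (z : R[i]) : complex.Im (x%:C%C * z) = x * complex.Im z.
Proof. by case: z => a b /=; rewrite mul0r addr0. Qed.

(** Real and imaginary parts are differentiated separately; together they say
    that differentiating multiplies each exponential by its frequency. *)
Lemma partial_deriv_trigpoly_eq0 (t : trigpoly R d) (B : 'M[R]_d) j x :
  partial_deriv j (fun y => trigpoly_eval t (B *m y)) x = 0 ->
  \sum_(n <- finsupp t) (t n * dotv n (B *m delta_mx j 0))%:C%C *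
    expi (- (2 * pi * dotv n (B *m x))) = 0.
Proof.
have pi0 : 2 * pi != 0 :> R by rewrite mulf_neq0// gt_eqF ?pi_gt0.
pose l n y : R := - (2 * pi * dotv n (B *m y)).
have lin n h : l n (h *: delta_mx j 0 + x) = h * l n (delta_mx j 0) + l n x.
  by rewrite /l mulmxDr -scalemxAr dotv_linear; ring.
rewrite /partial_deriv => -[].
have -> : (fun y => complex.Re (trigpoly_eval t (B *m y))) =
    (fun y => \sum_(n <- finsupp t) t n * cos (l n y)).
  apply/funext => y; rewrite /trigpoly_eval raddf_sum.
  by apply: eq_bigr => n _; apply: Re_realM.
have -> : (fun y => complex.Im (trigpoly_eval t (B *m y))) =
    (fun y => \sum_(n <- finsupp t) t n * sin (l n y)).
  apply/funext => y; rewrite /trigpoly_eval raddf_sum.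
  by apply: eq_bigr => n _; apply: Im_realM.
rewrite (derive_sum_comp _ _ _ lin) (derive_sum_comp _ _ _ lin) => dRe dIm.
apply/eqP; rewrite eq_complex; apply/andP; split.
  rewrite raddf_sum /=; apply/eqP/(mulfI pi0)/eqP; rewrite mulr0 -oppr_eq0.
  rewrite -[X in _ == X]dIm mulr_sumr -sumrN; apply/eqP/eq_bigr => n _.
  by rewrite /l mul0r subr0; ring.
rewrite raddf_sum /=; apply/eqP/(mulfI pi0)/eqP; rewrite mulr0.
rewrite -[X in _ == X]dRe mulr_sumr; apply/eqP/eq_bigr => n _.
by rewrite /l mul0r addr0; ring.
Qed.

End DirectionalDerivative.

Section Characters.
Variable R : realType.

Lemma expiD (u v : R) : expi (u + v) = expi u * expi v.
Proof.
rewrite /expi cosD sinD; apply/eqP; rewrite eq_complex /=.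
by apply/andP; split; apply/eqP; ring.
Qed.

Lemma expi0 : expi (0 : R) = 1.
Proof. by rewrite /expi cos0 sin0. Qed.

Lemma expiMn (u : R) k : expi (u *+ k) = expi u ^+ k.
Proof.
elim: k => [|k IHk]; first by rewrite mulr0n expi0.
by rewrite mulrS expiD IHk exprS.
Qed.

Lemma expi_sum (I : Type) (s : seq I) (u : I -> R) :
  expi (\sum_(i <- s) u i) = \prod_(i <- s) expi (u i).
Proof. by apply: (big_morph _ expiD expi0). Qed.

Lemma expi_int (z : int) : expi (- (2 * pi * z%:~R)) = 1 :> R[i].
Proof.
have e1 : expi (2 * pi : R) = 1.
  have -> : 2 * pi = pi *+ 2 :> R by rewrite mulr_natl.
  by rewrite /expi cos2pi sin2pi.
have en n : expi (2 * pi * n%:R : R) = 1 by rewrite mulr_natr expiMn e1 expr1n.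
have eN u : expi u = 1 -> expi (- u : R) = 1.
  by move=> u1; have := expiD u (- u); rewrite subrr expi0 u1 mul1r => <-.
apply: (eN); case: z => n; first exact: en.
by rewrite NegzE rmorphN mulrN; apply: (eN); apply: en.
Qed.

Lemma expi_eq1 (x : R) : expi (- (2 * pi * x)) = 1 -> exists z : int, x = z%:~R.
Proof.
move=> x1; exists (Num.floor x).
have /andP[fx xf] := floor_itv x.
pose y := x - (Num.floor x)%:~R.
have y1 : cos (pi * y *+ 2) = 1.
  have : expi (- (2 * pi * y)) = 1.
    have -> : - (2 * pi * y) = - (2 * pi * x) + - (2 * pi * (- Num.floor x)%:~R).
      by rewrite /y rmorphN; ring.
    by rewrite expiD x1 expi_int mulr1.
  move=> /(congr1 (@complex.Re R)) /=; rewrite cosN => <-.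
  by congr cos; rewrite -mulr_natl; ring.
have y0 : 0 <= y by rewrite subr_ge0.
have ylt1 : y < 1 by move: xf; rewrite intrD1 /y; lra.
apply/eqP; rewrite -subr_eq0 -/y; apply/negPn/negP => yn0.
have : 0 < sin (pi * y).
  have ygt0 : 0 < y by rewrite lt_neqAle eq_sym yn0.
  apply: sin_gt0_pi; apply/andP; split; first by rewrite mulr_gt0 ?pi_gt0.
  by rewrite -[X in _ < X]mulr1 ltr_pM2l ?pi_gt0.
move: y1; rewrite cos_mulr2n; have := cos2Dsin2 (pi * y).
move: (sin _) (cos _) => s c; nra.
Qed.

End Characters.

Section CosetSums.
Variables (R : realType) (d : nat) (M : 'M[int]_d).
Hypothesis M_neq0 : \det M != 0.

Local Notation A := (mxR R M).
Local Notation N := `|\det M|%N.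

Lemma mxRM m n p (B : 'M[int]_(m, n)) (C : 'M[int]_(n, p)) :
  mxR R (B *m C) = mxR R B *m mxR R C.
Proof. exact: map_mxM. Qed.

Lemma mxR_tr m n (B : 'M[int]_(m, n)) : mxR R B^T = (mxR R B)^T.
Proof. by rewrite /mxR map_trmx. Qed.

Lemma mxR_inj m n : injective (@mxR R m n).
Proof.
move=> B C /matrixP e; apply/matrixP => i j.
by have := e i j; rewrite !mxE => /eqP; rewrite eqr_int => /eqP.
Qed.

Lemma mxR_unit : A \in unitmx.
Proof. by rewrite unitmxE unitfE det_map_mx intr_eq0. Qed.

(** The character [exp (- 2 pi i (M^-1 n, k))] of Z^d / M Z^d at [n]. *)
Definition charac (n k : 'cV[int]_d) : R[i] :=
  expi (- (2 * pi * dotv n (invmx (mxR R M^T) *m mxR R k))).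

Lemma dotv_invmx (n : 'cV[int]_d) (x : 'cV[R]_d) :
  dotv n (invmx (mxR R M^T) *m x) =
  \sum_j (invmx A *m mxR R n) j 0 * x j 0.
Proof.
rewrite dotvE mxR_tr -trmx_inv mulmxA -trmx_mul mxE.
by apply: eq_bigr => j _; rewrite mxE.
Qed.

Lemma characDl m n k : charac (m + n) k = charac m k * charac n k.
Proof.
rewrite /charac -expiD; congr expi.
rewrite !dotv_invmx -opprD -mulrDr -big_split /=; congr (- (_ * _)).
apply: eq_bigr => j _; rewrite -mulrDl; congr (_ * _).
by rewrite /mxR map_mxD mulmxDr mxE.
Qed.

Lemma characDr n k l : charac n (k + l) = charac n k * charac n l.
Proof.
rewrite /charac -expiD; congr expi.
rewrite !dotv_invmx -opprD -mulrDr -big_split /=; congr (- (_ * _)).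
by apply: eq_bigr => j _; rewrite -mulrDr !mxE rmorphD.
Qed.

Lemma charac_prod n k :
  charac n k = \prod_j expi (- (2 * pi * ((invmx A *m mxR R n) j 0 * (k j 0)%:~R))).
Proof.
rewrite /charac dotv_invmx -expi_sum; congr expi.
by rewrite mulr_sumr -sumrN; apply: eq_bigr => j _; rewrite [mxR R k j 0]mxE.
Qed.

Lemma charac_lattice_l b k : charac (M *m b) k = 1.
Proof.
rewrite charac_prod big1 // => j _; rewrite mxRM mulKmx ?mxR_unit //.
by rewrite mxE -intrM expi_int.
Qed.

Lemma charac_lattice_r n b : charac n (M^T *m b) = 1.
Proof.
rewrite /charac mxRM mulKmx; last first.
  by rewrite mxR_tr unitmx_tr mxR_unit.
rewrite /dotv; under eq_bigr do rewrite mxE -intrM.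
by rewrite -rmorph_sum expi_int.
Qed.

(** The numbers [exp (- 2 pi i y_j)] for [y = M^-1 n] are [N]-th roots of
    unity, as [N M^-1] is an integer matrix. *)
Lemma charac_unity_root (n : 'cV[int]_d) j :
  expi (- (2 * pi * (invmx A *m mxR R n) j 0)) ^+ N = 1.
Proof.
rewrite -expiMn; set y := invmx A *m mxR R n.
have [z zE] : exists z : int, y j 0 *+ N = z%:~R.
  have yE : (\det M)%:~R *: y = mxR R (\adj M *m n).
    rewrite mxRM -[mxR R n](mulKVmx mxR_unit) -/y mulmxA -mxRM mul_adj_mx.
    by rewrite /mxR map_scalar_mx mul_scalar_mx.
  have := congr1 (fun B : 'cV_d => B j 0) yE; rewrite !mxE -mulr_natl.
  case: (\det M) => k /= ye; first by eexists; exact: ye.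
  exists (- (\adj M *m n) j 0); rewrite rmorphN /=.
  by rewrite [in RHS]mxE -ye NegzE rmorphN mulNr opprK.
by rewrite mulNrn -mulrnAr zE expi_int.
Qed.

Definition box_point (s : {ffun 'I_d -> 'I_N}) : 'cV[int]_d :=
  \col_j (s j : nat)%:Z.

(** A sum of powers of an [N]-th root of unity vanishes unless the root
    is 1, and the character of [n] involves such a root unless [n] is in
    M Z^d. *)
Lemma charac_box_sum n : \sum_s charac (- n) (box_point s) =
  (N ^ d)%:R * (upsample M (fun=> 1 : R) n)%:C%C.
Proof.
rewrite /upsample; case e : (lattice_coord M n) => [b|] /=.
  move/lattice_coordP : e => /(_ M_neq0) ->.
  under eq_bigr do rewrite -mulmxN charac_lattice_l.
  by rewrite sumr_const card_ffun !card_ord mulr1.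
rewrite mulr0; set w := fun j => expi (- (2 * pi * (invmx A *m mxR R (- n)) j 0)).
have wE s : charac (- n) (box_point s) = \prod_j w j ^+ (s j).
  rewrite charac_prod; apply: eq_bigr => j _; rewrite [box_point s j 0]mxE.
  by rewrite -expiMn; congr expi; rewrite -pmulrn -[RHS]mulr_natl; ring.
under eq_bigr do rewrite wE.
rewrite -(bigA_distr_bigA (fun j (k : 'I_N) => w j ^+ k)) /=.
have [j wj] : exists j, w j != 1.
  apply: contrapT => w1.
  have {}w1 j : exists z : int, (invmx A *m mxR R (- n)) j 0 = z%:~R.
    apply: expi_eq1; apply: contrapT => /eqP wj; apply: w1; exists j; exact: wj.
  have /boolp.choice[z zE] := w1.
  have : n = M *m (- \col_j z j).
    rewrite mulmxN -[LHS]opprK; congr (- _); apply: mxR_inj.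
    rewrite mxRM -[LHS](mulKVmx mxR_unit); congr (_ *m _).
    by apply/matrixP => i o; rewrite ord1 zE !mxE.
  by move/(lattice_coordP M_neq0); rewrite e.
rewrite (bigD1 j) //= (_ : \sum_k _ = 0) ?mul0r //.
have := subrX1 (w j) N; rewrite charac_unity_root subrr => /esym/eqP.
by rewrite mulf_eq0 subr_eq0 (negPf wj) /= => /eqP.
Qed.

(** Fourier inversion on the finite group Z^d / M Z^d: a function whose
    nontrivial Fourier coefficients vanish is constant. Summing over a box of
    side [N] instead of over the dual group covers every character equally
    often and spares a choice of digits. *)
Lemma coset_sums_const (W : 'cV[int]_d -> R) (s : seq 'cV[int]_d) :
  (forall k, (forall b, k <> M^T *m b) ->
     \sum_(n <- s) (W n)%:C%C * charac n k = 0) ->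
  forall a, \sum_(n <- s) W n * upsample M (fun=> 1) (a - n) =
            \sum_(n <- s) W n * upsample M (fun=> 1) (0 - n).
Proof.
move=> W0.
pose hat k := \sum_(n <- s) (W n)%:C%C * charac n k.
have inv a : (N ^ d)%:R * (\sum_(n <- s) W n * upsample M (fun=> 1) (a - n))%:C%C
    = \sum_sg hat (box_point sg).
  rewrite rmorph_sum mulr_sumr /=.
  under eq_bigr => n _.
    rewrite rmorphM mulrCA -charac_box_sum mulr_sumr.
    under eq_bigr do rewrite opprB characDl mulrA.
    over.
  rewrite exchange_big; apply: eq_bigr => sg _ /=; rewrite -mulr_suml -/(hat _).
  (* Either the character is trivial or the coefficient vanishes, so that
     the factor depending on [a] disappears. *)
  have [[b ->]|nb] := pselect (exists b, box_point sg = M^T *m b).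
    by rewrite charac_lattice_r mulr1.
  by rewrite /hat W0 ?mul0r // => b e; apply: nb; exists b.
move=> a; apply: complexI.
have Nd : (N ^ d)%:R != 0 :> R[i].
  by rewrite pnatr_eq0 expn_eq0 absz_eq0 negb_and M_neq0.
by apply: (mulfI Nd); rewrite !inv.
Qed.

Variables (D : set 'cV[int]_d) (t : trigpoly R d).
Hypotheses (hD : coset_reps M^T D) (ht : in_Z 1 M D t).

Lemma coset_rep_char k : (forall b, k <> M^T *m b) ->
  exists s, [/\ D s, s != 0 & forall n, charac n k = charac n s].
Proof.
move=> kM; have [s [[Ds [b kE]] _]] := hD.2 k; exists s; split=> //.
  by apply/eqP => s0; apply: (kM b); rewrite kE s0 add0r.
by move=> n; rewrite kE characDr charac_lattice_r mulr1.
Qed.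

Lemma in_Z_sum_rule0 : exists c, forall a, subdiv1 M t (fun=> 1) a = c.
Proof.
exists (\sum_(n <- finsupp t) t n * upsample M (fun=> 1) (0 - n)) => a.
rewrite subdiv1E //; apply: coset_sums_const => k kM.
have [s [Ds s0 ks]] := coset_rep_char kM.
have := ht Ds s0 (b := fun=> 0%N); rewrite sum_nat_const muln0 => /(_ isT).
rewrite multi_deriv0 => t0; rewrite -[RHS]t0.
by apply: eq_bigr => n _; rewrite ks.
Qed.

Lemma in_Z_sum_rule1 j : exists c, forall a,
  \sum_(n <- finsupp t) t n * (invmx A *m mxR R n) j 0 *
    upsample M (fun=> 1) (a - n) = c.
Proof.
eexists; apply: coset_sums_const => k kM.
have [s [Ds s0 ks]] := coset_rep_char kM.
have := ht Ds s0 (b := fun i => i == j : nat).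
rewrite (bigD1 j) //= eqxx big1 => [/(_ isT)|i /negPf -> //].
rewrite multi_deriv1.
move=> /partial_deriv_trigpoly_eq0 t0; rewrite -[RHS]t0.
apply: eq_bigr => n _; rewrite ks; congr ((_ * _)%:C%C * _).
rewrite dotv_invmx (bigD1 j) //= [delta_mx j 0 j 0]mxE !eqxx mulr1 big1 ?addr0 //.
by move=> i /negPf ij; rewrite [delta_mx j 0 i 0]mxE ij mulr0.
Qed.

End CosetSums.

(** * Counting cosets *)

Section CosetCount.
Variables (R : realType) (d : nat) (M : 'M[int]_d).
Hypothesis M_neq0 : \det M != 0.

Lemma unit_absz (z : int) : z \is a GRing.unit -> `|z|%N = 1%N.
Proof. by rewrite unfold_in => /orP[]/eqP ->. Qed.

Lemma smith_form : exists (L Z : 'M[int]_d) (dl : 'rV[int]_d),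
  [/\ L \in unitmx, Z \in unitmx, M = L *m diag_mx dl *m Z &
      `|\det M|%N = (\prod_i `|dl 0%R i|)%N].
Proof.
have [L Lu [Z Zu [s _ ME]]] := int_Smith_normal_form M.
exists L, Z, (\row_i s`_i).
have DE : \matrix_(i, j) (s`_i *+ (i == j :> nat)) = diag_mx (\row_i s`_i) :> 'M[int]_d.
  by apply/matrixP => i j; rewrite !mxE.
split=> //; first by rewrite ME DE.
rewrite unitmxE in Lu; rewrite unitmxE in Zu.
rewrite ME DE !det_mulmx det_diag !abszM (unit_absz Lu) (unit_absz Zu).
rewrite mul1n muln1.
by rewrite (big_morph absz abszM (erefl _)).
Qed.

Lemma sum_dvdz_shift (m : int) (z : int) B : m != 0 -> (`|m| <= B)%N ->
  \sum_(x < B | (x < `|m|)%N) ((m %| x%:Z - z)%Z : nat)%:R = 1 :> R.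
Proof.
move=> m0 mB; rewrite (big_ord_narrow mB) /=.
have zm : (`|(z %% m)%Z| < `|m|)%N.
  by rewrite -ltz_nat gez0_abs ?modz_ge0 // ltz_mod.
have xE (x : nat) : (x < `|m|)%N -> (m %| x%:Z - z)%Z = (x%:Z == (z %% m)%Z).
  by move=> xm; rewrite -eqz_mod_dvd -modz_abs modz_small // ltz_nat.
rewrite (bigD1 (Ordinal zm)) //= big1 => [|x xz].
  by rewrite xE // gez0_abs ?modz_ge0 // eqxx addr0.
rewrite xE //; case: eqP => // e; case/eqP: xz; apply: val_inj => /=.
by rewrite -e.
Qed.

(** The points [L x], with [x] in the box of the invariant factors of [M],
    represent every coset of M Z^d once, and there are |det M| of them. *)
Lemma sum_coefs_cosets (t : trigpoly R d) c :
  (forall a, subdiv1 M t (fun=> 1) a = c) ->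
  \sum_(n <- finsupp t) t n = `|\det M|%N%:R * c.
Proof.
move=> tc; have [L [Z [dl [Lu Zu ME detE]]]] := smith_form.
have dl0 i : dl 0 i != 0.
  apply: contraNneq M_neq0 => di; rewrite -absz_eq0 detE.
  by rewrite (bigD1 i) //= di mul0n.
(* [B] only has to be large enough for all the sides of the box. *)
pose B := (\sum_i `|dl 0%R i|)%N.
have dB i : (`|dl 0%R i| <= B)%N by rewrite /B (bigD1 i) //= leq_addr.
pose Q (i : 'I_d) : pred 'I_B := fun x => (x < `|dl 0%R i|)%N.
pose pt (f : {ffun 'I_d -> 'I_B}) : 'cV[int]_d := \col_i (f i : nat)%:Z.
have indE f n : upsample M (fun=> 1 : R) (L *m pt f - n) =
    \prod_i ((dl 0%R i %| (f i : nat)%:Z - (invmx L *m n) i 0%R)%Z : nat)%:R.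
  set u := L *m pt f - n.
  have yE i : (invmx L *m u) i 0 = (f i : nat)%:Z - (invmx L *m n) i 0.
    by rewrite mulmxBr mulKmx // !mxE.
  under eq_bigr do rewrite -yE.
  rewrite /upsample; case e : (lattice_coord M u) => [b|] /=.
    move/(lattice_coordP M_neq0) : e => e; rewrite big1 // => i _.
    rewrite e ME -!mulmxA mulKmx // mul_diag_mx mxE.
    by rewrite dvdz_mulr.
  suff [i /negPf ui] : exists i, ~~ (dl 0%R i %| (invmx L *m u) i 0%R)%Z.
    by rewrite (bigD1 i) //= ui mul0r.
  apply: contrapT => nu.
  have {}nu i : exists k, (invmx L *m u) i 0 = k * dl 0 i.
    by apply/dvdzP; apply: contrapT => /negP ui; apply: nu; exists i.
  have /boolp.choice[k kE] := nu.
  have : u = M *m (invmx Z *m \col_i k i).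
    rewrite ME mulmxA mulmxK // -mulmxA mul_diag_mx.
    rewrite -[LHS](mulKVmx Lu); congr (_ *m _); apply/matrixP => i o.
    by rewrite ord1 kE !mxE mulrC.
  by move/(lattice_coordP M_neq0); rewrite e.
have <- : \sum_(f in family Q) subdiv1 M t (fun=> 1) (L *m pt f) =
    `|\det M|%N%:R * c.
  rewrite (eq_bigr (fun=> 1 * c)) => [|f _]; last by rewrite tc mul1r.
  rewrite -mulr_suml; congr (_ * _); rewrite detE natr_prod.
  transitivity (\sum_(f in family Q) \prod_(i < d) (1 : R)).
    by apply: eq_bigr => f _; rewrite big1.
  rewrite -(bigA_distr_big_dep Q (fun _ _ => 1)) /=.
  apply: eq_bigr => i _; rewrite (big_ord_narrow (dB i)) /=.
  by rewrite sumr_const card_ord.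
under [RHS]eq_bigr do rewrite subdiv1E //.
rewrite exchange_big /=; apply: eq_bigr => n _; rewrite -mulr_sumr.
under eq_bigr do rewrite indE.
rewrite -(bigA_distr_big_dep Q (fun i (x : 'I_B) =>
  ((dl 0%R i %| (x : nat)%:Z - (invmx L *m n) i 0%R)%Z : nat)%:R)) /=.
rewrite big1 ?mulr1 // => i _; exact: sum_dvdz_shift.
Qed.

End CosetCount.

(** * Action on constants *)

Lemma bounded_funE (T : Type) (x0 : T) (R : realType)
    (V : pseudoMetricNormedZmodType R) (f : T -> V) :
  bounded_fun f <-> exists C : R, forall x, `|f x| <= C.
Proof.
have PT := @globally_properfilter T setT x0 I.
by rewrite /= ex_bound; split=> -[C fC]; exists C => x *; apply: fC.
Qed.

Section Locality.
Variables (R : realType) (d : nat) (M : 'M[int]_d).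
Hypothesis M_neq0 : \det M != 0.

Definition arguments (s : seq 'cV[int]_d) (a : 'cV[int]_d) : seq 'cV[int]_d :=
  pmap (fun n => lattice_coord M (a - n)) s.

Lemma upsample_arguments (V : nmodType) s a n (f g : 'cV[int]_d -> V) :
  n \in s -> {in arguments s a, f =1 g} ->
  upsample M f (a - n) = upsample M g (a - n).
Proof.
rewrite /upsample => ns fg; case e : (lattice_coord M (a - n)) => [b|] //=.
by apply: fg; rewrite mem_pmap; apply/mapP; exists n.
Qed.

Lemma subdiv1_local (t : trigpoly R d) f g a :
  {in arguments (finsupp t) a, f =1 g} -> subdiv1 M t f a = subdiv1 M t g a.
Proof.
move=> fg; rewrite !subdiv1E //; apply: eq_big_seq => n nt.
by rewrite (upsample_arguments nt fg).
Qed.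

Lemma subdiv_local N (T : trigmx R d N) F G a :
  {in arguments (finsupp T) a, F =1 G} -> subdiv M T F a = subdiv M T G a.
Proof.
move=> fg; rewrite !subdivE //; apply: eq_big_seq => n nt.
by rewrite (upsample_arguments nt fg).
Qed.

Lemma bounded_restriction (f : 'cV[int]_d -> R) (s : seq 'cV[int]_d) :
  exists g, bounded_fun g /\ {in s, f =1 g}.
Proof.
exists (fun n => if n \in s then f n else 0); split; last by move=> n /= ->.
apply/(bounded_funE 0); exists (\sum_(n <- s) `|f n|) => n.
case: ifPn => [ns|_]; last by rewrite normr0 sumr_ge0.
by rewrite (big_rem n) //= lerDl sumr_ge0.
Qed.

End Locality.

Section Constants.
Variables (R : realType) (d : nat) (M : 'M[int]_d).
Hypothesis M_neq0 : \det M != 0.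

Local Notation A := (mxR R M).
Local Notation e_ l := (delta_mx l 0 : 'cV[int]_d).

Variables (t : trigpoly R d) (c : R).
Hypothesis rule0 : forall a, subdiv1 M t (fun=> 1) a = c.
Hypothesis rule1 : forall j, exists c1, forall a,
  \sum_(n <- finsupp t) t n * (invmx A *m mxR R n) j 0 *
    upsample M (fun=> 1) (a - n) = c1.

Lemma dotv_diff (b : 'cV[int]_d) j (v : 'cV[R]_d) :
  dotv b v - dotv (b - e_ j) v = v j 0.
Proof.
rewrite /dotv -sumrB (bigD1 j) //= big1 ?addr0.
  by rewrite !mxE !eqxx rmorphB /=; ring.
by move=> i ij; rewrite !mxE (negPf ij) subr0 subrr.
Qed.

(** Writing [M^-1 (a - n)] as [M^-1 a - M^-1 n] splits the sum into a part
    linear in [a], by the first sum rule, and a constant, by the second. *)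
Lemma subdiv1_linear (v : 'cV[R]_d) : exists c1 : R, forall a,
  subdiv1 M t (fun n => dotv n v) a =
  c * \sum_j (invmx A *m mxR R a) j 0 * v j 0 - c1.
Proof.
have /boolp.choice[c1 c1E] := rule1.
exists (\sum_j c1 j * v j 0) => a.
pose y (n : 'cV[int]_d) := invmx A *m mxR R n.
have upE n : upsample M (fun b => dotv b v) (a - n) =
    \sum_j (y a j 0 - y n j 0) * upsample M (fun=> 1) (a - n) * v j 0.
  rewrite /upsample; case e : (lattice_coord M (a - n)) => [b|] /=; last first.
    by rewrite big1 // => j _; rewrite mulr0 mul0r.
  move/(lattice_coordP M_neq0) : e => e.
  apply: eq_bigr => j _; rewrite mulr1; congr (_ * _).
  suff : mxR R b = y a - y n by move=> /matrixP /(_ j 0); rewrite !mxE.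
  rewrite /y -mulmxBr -[mxR R b](mulKmx (mxR_unit R M_neq0)) -mxRM -e.
  by rewrite /mxR map_mxB.
rewrite subdiv1E //; under eq_bigr do rewrite upE mulr_sumr.
rewrite exchange_big mulr_sumr -sumrB; apply: eq_bigr => j _.
rewrite -(rule0 a) -(c1E j a) subdiv1E // mulrA -mulrBl mulr_suml -sumrB.
by rewrite mulr_suml; apply: eq_bigr => n _; rewrite /y; ring.
Qed.

(** The intertwining relation only involves finitely many values at each
    point, so it may be applied to a linear function, unbounded as it is:
    its differences form the constant sequence [v]. *)
Lemma subdiv_cst (T : trigmx R d d) (v : 'cV[R]_d) a :
  (forall f : 'cV[int]_d -> R, bounded_fun f ->
     nabla1 (subdiv1 M t f) = subdiv M T (nabla1 f)) ->
  subdiv M T (fun=> v) a = c *: (invmx (mxR R M^T) *m v).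
Proof.
move=> tT; pose lin n : R := dotv n v.
(* [s] collects the points that either side looks at. *)
pose sT := arguments M (finsupp T) a.
pose s := arguments M (finsupp t) a ++
  (flatten [seq arguments M (finsupp t) (a - e_ j) | j <- enum 'I_d] ++
  (sT ++ flatten [seq [seq b - e_ j | b <- sT] | j <- enum 'I_d])).
have [g [gb gs]] := bounded_restriction lin s.
transitivity (subdiv M T (nabla1 g) a).
  apply: subdiv_local => // b bs; apply/matrixP => j o; rewrite ord1 mxE.
  rewrite -!gs ?dotv_diff //.
    rewrite !mem_cat; apply/or4P; constructor 4; apply/flattenP.
    exists [seq b - e_ j | b <- sT]; last exact: map_f.
    by apply/mapP; exists j; rewrite ?mem_enum.
  by rewrite !mem_cat; apply/or4P; constructor 3.
rewrite -tT //; apply/matrixP => j o; rewrite ord1 mxE.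
rewrite -!(@subdiv1_local _ _ _ M_neq0 _ lin g); first last.
- by move=> b bs; apply: gs; rewrite mem_cat bs.
- move=> b bs; apply: gs; rewrite !mem_cat; apply/or4P; constructor 2.
  apply/flattenP; exists (arguments M (finsupp t) (a - e_ j)) => //.
  by apply/mapP; exists j; rewrite ?mem_enum.
have [c1 c1E] := subdiv1_linear v; rewrite !c1E opprB addrA subrK -mulrBr mxE.
congr (_ * _); rewrite -sumrB mxE; apply: eq_bigr => i _; rewrite -mulrBl.
congr (_ * _); rewrite mxR_tr -trmx_inv [RHS]mxE.
have : invmx A *m mxR R a - invmx A *m mxR R (a - e_ j) = col j (invmx A).
  by rewrite -mulmxBr /mxR -map_mxB subKr map_delta_mx colE.
by move=> /matrixP /(_ i 0); rewrite [LHS]mxE [X in _ + X]mxE => ->; rewrite mxE.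
Qed.

(** The scheme [T] exists by the first sum rule for [t]; as it maps constants
    to constants, its entries satisfy that rule too, and [Q] exists for the
    same reason. *)
Lemma intertwined_exists : exists (T : trigmx R d d) (Q : trigmx R d (d * d)),
  nabla_intertwined M t T Q.
Proof.
have [T TE] := nabla1_factor M_neq0 rule0; exists T.
have Tc i k a : subdiv1 M (trigmx_entry T i k) (fun=> 1) a =
    (c *: (invmx (mxR R M^T) *m delta_mx k 0) : 'cV[R]_d) i 0.
  have := @subdiv_cst T (delta_mx k 0) a (fun f _ => TE f).
  move=> /matrixP /(_ i 0) <-; rewrite subdiv_coord // (bigD1 k) //= big1 ?addr0.
    by congr (subdiv1 _ _ _ _); apply/funext => b; rewrite mxE !eqxx.
  move=> l lk; rewrite (@subdiv1_local _ _ _ M_neq0 _ _ (fun=> 0)).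
    rewrite subdiv1E // big1 // => n _; rewrite /upsample.
    by case: lattice_coord => [b|] /=; rewrite mulr0.
  by move=> b _ /=; rewrite mxE (negPf lk).
have [Q QE] := nabla_factor M_neq0 Tc.
by exists Q; split=> f _; [apply: TE | apply: QE].
Qed.

End Constants.

(** * Norms *)

Section ColumnNorm.
Variable R : realType.

Lemma normv_leP n (x : 'cV[R]_n) C : 0 <= C ->
  (`|x| <= C) <-> (forall i, `|x i 0| <= C).
Proof.
move=> C0; rewrite [Num.norm x]mx_normrE; split=> [xC i|xC].
  by apply: le_trans xC; apply: (le_bigmax _ _ (i, 0)).
by apply: bigmax_le => // -[i j] _ /=; rewrite ord1.
Qed.

Lemma coord_le_norm n (x : 'cV[R]_n) i : `|x i 0| <= `|x|.
Proof. exact: (normv_leP x (normr_ge0 x)).1. Qed.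

Lemma mulmx_bound m n (B : 'M[R]_(m, n)) : exists2 C : R, 0 <= C &
  forall x : 'cV[R]_n, `|B *m x| <= C * `|x|.
Proof.
pose C := \sum_i \sum_j `|B i j|.
have C0 : 0 <= C by apply: sumr_ge0 => i _; apply: sumr_ge0.
exists C => // x.
apply/normv_leP => [|i]; first exact: mulr_ge0.
rewrite mxE (le_trans (ler_norm_sum _ _ _)) //.
rewrite /C (bigD1 i) //= mulrDl mulr_suml.
apply: (@le_trans _ _ (\sum_j `|B i j| * `|x|)); last first.
  by rewrite lerDl mulr_ge0 // sumr_ge0 // => k _; apply: sumr_ge0.
by apply: ler_sum => j _; rewrite normrM ler_wpM2l // coord_le_norm.
Qed.

(** Finite in finite dimension, so that nothing is lost with [fine]. *)
Definition opnorm n (B : 'M[R]_n) : R := fine (mx_opnorm B).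

Lemma mx_opnorm_le n (B : 'M[R]_n) C : 0 <= C ->
  (forall x : 'cV[R]_n, `|B *m x| <= C * `|x|) -> (mx_opnorm B <= C%:E)%E.
Proof.
move=> C0 BC; apply: ge_ereal_sup => _ [x /= x1 <-]; rewrite lee_fin.
by rewrite (le_trans (BC x)) // -[leRHS]mulr1 ler_wpM2l.
Qed.

Lemma mx_opnorm_ge0 n (B : 'M[R]_n) : (0 <= mx_opnorm B)%E.
Proof.
by apply: ereal_sup_ubound; exists 0; rewrite /= ?mulmx0 ?normr0.
Qed.

Lemma opnormE n (B : 'M[R]_n) : mx_opnorm B = (opnorm B)%:E.
Proof.
rewrite fineK // ge0_fin_numE ?mx_opnorm_ge0 //.
have [C C0 BC] := mulmx_bound B.
exact: le_lt_trans (mx_opnorm_le C0 BC) (ltry _).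
Qed.

Lemma opnorm_ge0 n (B : 'M[R]_n) : 0 <= opnorm B.
Proof. by rewrite -lee_fin -opnormE mx_opnorm_ge0. Qed.

Lemma opnorm_le n (B : 'M[R]_n) C : 0 <= C ->
  (forall x : 'cV[R]_n, `|B *m x| <= C * `|x|) -> opnorm B <= C.
Proof. by move=> C0 BC; rewrite -lee_fin -opnormE mx_opnorm_le. Qed.

Lemma norm_mulmx_le n (B : 'M[R]_n) (x : 'cV[R]_n) : `|B *m x| <= opnorm B * `|x|.
Proof.
have [->|x0] := eqVneq x 0; first by rewrite mulmx0 !normr0 mulr0.
rewrite -ler_pdivrMr ?normr_gt0 // -lee_fin -opnormE.
apply: ereal_sup_ubound; exists (`|x|^-1 *: x) => /=.
  by rewrite normrZ normfV normr_id mulVf ?normr_eq0.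
by rewrite -scalemxAr normrZ normfV normr_id mulrC.
Qed.

Lemma opnormM n (B C : 'M[R]_n) : opnorm (B *m C) <= opnorm B * opnorm C.
Proof.
apply: opnorm_le => [|x]; first by rewrite mulr_ge0 ?opnorm_ge0.
rewrite -mulmxA (le_trans (norm_mulmx_le _ _)) // -mulrA.
by rewrite ler_wpM2l ?opnorm_ge0 // norm_mulmx_le.
Qed.

Lemma opnorm_gt0 n (B : 'M[R]_n) : (0 < n)%N -> B \in unitmx -> 0 < opnorm B.
Proof.
move=> n0 Bu; rewrite lt_neqAle opnorm_ge0 andbT eq_sym.
apply/eqP => B0; pose x : 'cV[R]_n := const_mx 1.
have : `|B *m x| <= 0 by rewrite (le_trans (norm_mulmx_le _ _)) // B0 mul0r.
rewrite normr_le0 => /eqP Bx0.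
have : x = 0 by rewrite -[x](mulKmx Bu) Bx0 mulmx0.
move=> /matrixP /(_ (Ordinal n0) 0) /eqP; rewrite !mxE; apply/negP.
exact: oner_neq0.
Qed.

End ColumnNorm.

Section SequenceNorm.
Variables (R : realType) (d : nat).

Lemma linf_normP N (f : 'cV[int]_d -> 'cV[R]_N) C :
  (linf_norm f <= C%:E)%E <-> (forall a, `|f a| <= C).
Proof.
split=> [fC a|fC]; last by apply: ge_ereal_sup => _ [a _ <-]; rewrite lee_fin.
by rewrite -lee_fin (le_trans _ fC) //; apply: ereal_sup_ubound; exists a.
Qed.

Lemma linf_norm_ge0 N (f : 'cV[int]_d -> 'cV[R]_N) : (0 <= linf_norm f)%E.
Proof.
apply: (@le_trans _ _ `|f 0|%:E); first by rewrite lee_fin.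
by apply: ereal_sup_ubound; exists 0.
Qed.

(** Only meaningful for bounded [f]: [fine] sends infinite norms to 0. *)
Definition supnorm N (f : 'cV[int]_d -> 'cV[R]_N) : R := fine (linf_norm f).

Lemma supnormE N (f : 'cV[int]_d -> 'cV[R]_N) :
  bounded_fun f -> linf_norm f = (supnorm f)%:E.
Proof.
move=> /(bounded_funE 0)[C fC]; rewrite fineK // ge0_fin_numE ?linf_norm_ge0 //.
exact: le_lt_trans ((linf_normP _ _).2 fC) (ltry _).
Qed.

Lemma supnorm_ge0 N (f : 'cV[int]_d -> 'cV[R]_N) : 0 <= supnorm f.
Proof. by rewrite fine_ge0 // linf_norm_ge0. Qed.

Lemma norm_le_supnorm N (f : 'cV[int]_d -> 'cV[R]_N) a :
  bounded_fun f -> `|f a| <= supnorm f.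
Proof. by move=> /supnormE fE; apply: (linf_normP _ _).1; rewrite fE. Qed.

Lemma supnorm_le N (f : 'cV[int]_d -> 'cV[R]_N) C :
  bounded_fun f -> (forall a, `|f a| <= C) -> supnorm f <= C.
Proof. by move=> /supnormE fE fC; rewrite -lee_fin -fE; apply/linf_normP. Qed.

Lemma linf_opnorm_ge0 N N'
    (S : ('cV[int]_d -> 'cV[R]_N) -> 'cV[int]_d -> 'cV[R]_N') :
  (0 <= linf_opnorm S)%E.
Proof.
apply: (@le_trans _ _ (linf_norm (S (fun=> 0)))); first exact: linf_norm_ge0.
apply: ereal_sup_ubound; exists (fun=> 0) => //=.
by apply/linf_normP => a; rewrite normr0.
Qed.

Lemma supnorm_opnorm N N'
    (S : ('cV[int]_d -> 'cV[R]_N) -> 'cV[int]_d -> 'cV[R]_N') (s : R) f a :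
  (forall c g, S (fun b => c *: g b) = fun b => c *: S g b) ->
  linf_opnorm S = s%:E -> bounded_fun f -> `|S f a| <= s * supnorm f.
Proof.
move=> SZ Ss fb.
have s0 : 0 <= s by rewrite -lee_fin -Ss linf_opnorm_ge0.
have [f0|] := eqVneq (supnorm f) 0.
  have -> : f = fun b => 0 *: f b.
    apply/funext => b; apply/eqP; rewrite scale0r -normr_le0 -f0.
    exact: norm_le_supnorm.
  by rewrite SZ scale0r normr0 mulr_ge0 ?supnorm_ge0.
rewrite -normr_gt0 ger0_norm ?supnorm_ge0 // => f0.
pose g b := (supnorm f)^-1 *: f b.
have -> : S f = fun b => supnorm f *: S g b.
  rewrite -SZ; congr S; apply/funext => b.
  by rewrite scalerA divff ?scale1r ?gt_eqF.
rewrite normrZ ger0_norm ?supnorm_ge0 // mulrC ler_wpM2r ?supnorm_ge0 //.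
apply: (linf_normP _ _).1; rewrite -Ss; apply: ereal_sup_ubound; exists g => //=.
apply/linf_normP => b; rewrite normrZ normfV ger0_norm ?supnorm_ge0 //.
by rewrite ler_pdivrMl // mulr1 norm_le_supnorm.
Qed.

End SequenceNorm.

(** * Geometric sequences *)

Section Geometric.
Variable R : realType.

Lemma bernoulli_le (x : R) L : 0 <= x <= 1 -> 1 - L%:R * x <= (1 - x) ^+ L.
Proof.
move=> /andP[x0 x1]; elim: L => [|L IHL]; first by rewrite mul0r subr0 expr0.
rewrite exprS (le_trans _ (ler_wpM2l _ IHL)) ?subr_ge0 //.
by rewrite -subr_ge0 -natr1; have := ler0n R L; move: (L%:R) => l l0; nra.
Qed.

(** The rate is close enough to 1 for its [L]-th power to exceed [mu], by
    Bernoulli's inequality, and the constant takes care of the first [L]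
    terms. *)
Lemma geometric_decay (e : nat -> R) L mu : (0 < L)%N -> mu < 1 ->
  (forall k, 0 <= e k) -> (forall k, e (k + L)%N <= mu * e k) ->
  exists C rho, [/\ 0 <= C, 0 < rho < 1 & forall k, e k <= C * rho ^+ k].
Proof.
move=> L0 mu1 e0 eL.
(* Replacing [mu] by [nu >= 1/2] keeps the rate positive. *)
pose nu := Num.max mu 2^-1; have [munu nu0 nu1] : [/\ mu <= nu, 0 < nu & nu < 1].
  rewrite /nu le_max lexx lt_max gt_max mu1 invr_gt0 ltr0n orbT.
  by split=> //; rewrite invf_lt1 ?ltr1n.
have LR : 1 <= L%:R :> R by rewrite ler1n.
pose rho := 1 - (1 - nu) / L%:R.
have x01 : 0 < (1 - nu) / L%:R < 1.
  apply/andP; split; first by rewrite divr_gt0 ?subr_gt0 // ltr0n.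
  by rewrite ltr_pdivrMr ?mul1r; lra.
have rho01 : 0 < rho < 1 by rewrite /rho; lra.
have /andP[rho0 rho1] := rho01.
have murho : mu <= rho ^+ L.
  apply: le_trans munu _; apply: le_trans (bernoulli_le _ _); last by lra.
  by rewrite mulrC divfK ?pnatr_eq0 -?lt0n //; lra.
pose C := \sum_(r < L) e r / rho ^+ r.
have C0 : 0 <= C.
  by apply: sumr_ge0 => r _; rewrite divr_ge0 // exprn_ge0 // ltW.
exists C, rho; split=> // k.
elim/ltn_ind: k => k IHk; have [kL|Lk] := ltnP k L.
  rewrite -ler_pdivrMr ?exprn_gt0 // /C (bigD1 (Ordinal kL)) //= lerDl.
  by apply: sumr_ge0 => r _; rewrite divr_ge0 // exprn_ge0 // ltW.
rewrite -(subnK Lk); apply: le_trans (eL _) _.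
rewrite exprD mulrA mulrC; apply: (@le_trans _ _ (e (k - L)%N * rho ^+ L)).
  by rewrite ler_wpM2l.
apply: ler_wpM2r; first by rewrite exprn_ge0 // ltW.
by apply: IHk; rewrite ltn_subrL L0 (leq_trans L0 Lk).
Qed.

(** The intervals of radius [C rho^k / (1 - rho)] around the terms are
    nested, which locates the limit. *)
Lemma geometric_limit (u : nat -> R) C rho : 0 < rho < 1 ->
  (forall k, `|u k.+1 - u k| <= C * rho ^+ k) ->
  exists l, forall k, `|u k - l| <= C / (1 - rho) * rho ^+ k.
Proof.
move=> /andP[rho0 rho1] uC.
have C0 : 0 <= C by have := le_trans (normr_ge0 _) (uC 0%N); rewrite expr0 mulr1.
pose r k := C / (1 - rho) * rho ^+ k.
have r0 k : 0 <= r k.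
  by rewrite mulr_ge0 ?divr_ge0 ?subr_ge0 ?exprn_ge0 // ltW.
have rE k : r k - r k.+1 = C * rho ^+ k.
  have rho_neq1 : 1 - rho != 0 by rewrite subr_eq0 gt_eqF.
  by rewrite /r exprS; move: (rho ^+ k) => z; field.
have lo : {homo (fun k => u k - r k) : m n / (m <= n)%N >-> m <= n}.
  apply: homo_leq => [//|x y z|k]; first exact: le_trans.
  have := uC k; rewrite -rE ler_norml => /andP[]; lra.
have hi : {homo (fun k => u k + r k) : m n / (m <= n)%N >-> n <= m}.
  apply: homo_leq => [//|x y z xy yz|k]; first exact: le_trans yz xy.
  have := uC k; rewrite -rE ler_norml => /andP[]; lra.
have lohi j k : u j - r j <= u k + r k.
  apply: le_trans (lo _ _ (leq_maxl j k)) _.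
  apply: le_trans (hi _ _ (leq_maxr j k)).
  by have := r0 (maxn j k); lra.
pose E := [set u k - r k | k in [set: nat]].
have Eub k : ubound E (u k + r k) by move=> _ [j _ <-].
exists (sup E) => k; rewrite -/(r k) ler_norml.
have : u k - r k <= sup E.
  by apply: ub_le_sup; [exists (u 0%N + r 0%N) | exists k].
have : sup E <= u k + r k by apply: ge_sup => //; exists (u 0%N - r 0%N), 0%N.
by move=> *; apply/andP; split; lra.
Qed.

Lemma geometric_limit_col n (u : nat -> 'cV[R]_n) C rho : 0 < rho < 1 -> 0 <= C ->
  (forall k, `|u k.+1 - u k| <= C * rho ^+ k) ->
  exists l, forall k, `|u k - l| <= C / (1 - rho) * rho ^+ k.
Proof.
move=> rho01 C0 uC.
have /boolp.choice[l lE] i : exists l, forall k,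
    `|u k i 0 - l| <= C / (1 - rho) * rho ^+ k.
  apply: geometric_limit => // k; apply: le_trans (uC k).
  by have := coord_le_norm (u k.+1 - u k) i; rewrite !mxE.
exists (\col_i l i) => k; apply/normv_leP => [|i]; last by rewrite !mxE.
by case/andP: rho01 => *; rewrite mulr_ge0 ?divr_ge0 ?subr_ge0 ?exprn_ge0 // ltW.
Qed.

End Geometric.

(** * Bounds for schemes and differences *)

Section SubdivisionBounds.
Variables (R : realType) (d : nat) (M : 'M[int]_d).
Hypothesis M_neq0 : \det M != 0.

Local Notation e_ l := (delta_mx l 0 : 'cV[int]_d).

Lemma subdiv_scale N (T : trigmx R d N) c F :
  subdiv M T (fun b => c *: F b) = fun a => c *: subdiv M T F a.
Proof.
apply/funext => a; rewrite !subdivE // scaler_sumr; apply: eq_bigr => n _.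
rewrite /upsample; case: lattice_coord => [b|] /=; first by rewrite scalemxAr.
by rewrite mulmx0 scaler0.
Qed.

Lemma iter_subdiv_scale N (T : trigmx R d N) k c F :
  iter k (subdiv M T) (fun b => c *: F b) =
  fun a => c *: iter k (subdiv M T) F a.
Proof. by elim: k => // k IHk; rewrite !iterS IHk subdiv_scale. Qed.

Lemma subdiv_sub N (T : trigmx R d N) F G a :
  subdiv M T (fun b => F b - G b) a = subdiv M T F a - subdiv M T G a.
Proof.
rewrite !subdivE // -sumrB; apply: eq_bigr => n _.
rewrite -mulmxBr /upsample; case: lattice_coord => [b|] //=.
by rewrite subr0.
Qed.

Lemma subdiv_bound N (T : trigmx R d N) : exists2 C : R, 0 <= C &
  forall F K a, 0 <= K ->
    {in arguments M (finsupp T) a, forall b, `|F b| <= K} ->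
    `|subdiv M T F a| <= C * K.
Proof.
have /boolp.choice[C CE] n : exists C : R, 0 <= C /\
    forall x : 'cV[R]_N, `|T n *m x| <= C * `|x|.
  by have [C C0 CE] := mulmx_bound (T n); exists C.
exists (\sum_(n <- finsupp T) C n); first by apply: sumr_ge0 => n _; case: (CE n).
move=> F K a K0 FK; rewrite subdivE // mulr_suml (le_trans (ler_norm_sum _ _ _)) //.
rewrite big_seq [leRHS]big_seq; apply: ler_sum => n nT; have [Cn0 Cn] := CE n.
apply: le_trans (Cn _) _; apply: ler_wpM2l => //; rewrite /upsample.
case e : (lattice_coord M (a - n)) => [b|] /=; last by rewrite normr0.
by apply: FK; rewrite mem_pmap; apply/mapP; exists n.
Qed.

Lemma subdiv_bounded N (T : trigmx R d N) F :
  bounded_fun F -> bounded_fun (subdiv M T F).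
Proof.
move=> /(bounded_funE 0)[K FK]; have [C C0 CT] := subdiv_bound T.
apply/(bounded_funE 0); exists (C * K) => a; apply: CT => //.
exact: le_trans (FK 0).
Qed.

Lemma iter_subdiv_bounded N (T : trigmx R d N) k F :
  bounded_fun F -> bounded_fun (iter k (subdiv M T) F).
Proof. by move=> Fb; elim: k => //= k; apply: subdiv_bounded. Qed.

Lemma nabla_bounded N (F : 'cV[int]_d -> 'cV[R]_N) :
  bounded_fun F -> bounded_fun (nabla F).
Proof.
move=> /(bounded_funE 0)[K FK]; apply/(bounded_funE 0); exists (K + K) => a.
have K0 : 0 <= K by apply: le_trans (FK 0).
apply/normv_leP => [|r]; first exact: addr_ge0.
case/mxvec_indexP: r => i j; rewrite nablaE (le_trans (ler_normB _ _)) //.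
by apply: lerD; apply: le_trans (coord_le_norm _ _) (FK _).
Qed.

Lemma nabla1_bounded (f : 'cV[int]_d -> R) :
  bounded_fun f -> bounded_fun (nabla1 f).
Proof.
move=> /(bounded_funE 0)[K fK]; apply/(bounded_funE 0); exists (K + K) => a.
have K0 : 0 <= K by apply: le_trans (fK 0).
apply/normv_leP => [|r]; first exact: addr_ge0.
by rewrite mxE (le_trans (ler_normB _ _)) // lerD.
Qed.

(** Walk from [b] to [a] by unit steps along the axes. *)
Lemma nabla_lipschitz N (h : 'cV[int]_d -> 'cV[R]_N) a b : bounded_fun h ->
  `|h a - h b| <= (\sum_j `|(a - b) j 0|%:~R) * supnorm (nabla h).
Proof.
move=> hb; set D := supnorm _.
have D0 : 0 <= D := supnorm_ge0 _.
have unit l c : `|h (c + e_ l) - h c| <= D.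
  apply/normv_leP => // i.
  have := coord_le_norm (nabla h (c + e_ l)) (mxvec_index i l).
  rewrite nablaE addrK !mxE => /le_trans; apply.
  exact/norm_le_supnorm/nabla_bounded.
pose P k (x : R) := forall c, `|h (c + k) - h c| <= x * D.
have PD k1 x1 k2 x2 : P k1 x1 -> P k2 x2 -> P (k1 + k2) (x1 + x2).
  move=> P1 P2 c; rewrite addrA mulrDl [leRHS]addrC.
  by rewrite -(subrKA (h (c + k1))) (le_trans (ler_normD _ _)) // lerD.
have P0 : P 0 0 by move=> c; rewrite addr0 subrr normr0 mul0r.
have Pn l n : P (e_ l *+ n) n%:R.
  elim: n => [//|n Pn]; rewrite mulrS [n.+1%:R]mulrS; apply: PD => // c.
  by rewrite mul1r.
suff /(_ b) : P (a - b) (\sum_j `|(a - b) j 0|%:~R) by rewrite [b + _]addrC subrK.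
rewrite {1}(intcol_sum (a - b)); apply: (big_ind2 P) => // l _.
case: ((a - b) l 0) => n; first exact: Pn.
move=> c; have := Pn l n.+1 (c - e_ l *+ n.+1).
by rewrite NegzE mulrNz normrN subrK distrC.
Qed.

End SubdivisionBounds.

(** * Convergence *)

(** As [B] is nonzero, the bound on the product of the norms also says that
    the norm of [S] is finite. *)
Lemma contraction_factor (R : realType) (d n N N' : nat) (B : 'M[R]_n)
    (S : ('cV[int]_d -> 'cV[R]_N) -> 'cV[int]_d -> 'cV[R]_N') (mu : R) :
  (0 < n)%N -> B \in unitmx -> (mx_opnorm B * linf_opnorm S <= mu%:E)%E ->
  exists s, linf_opnorm S = s%:E /\ opnorm B * s <= mu.
Proof.
move=> n0 Bu; have B0 := opnorm_gt0 n0 Bu.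
rewrite opnormE; case: (linf_opnorm S) (linf_opnorm_ge0 S) => [s|_|//].
  by move=> _; rewrite -EFinM lee_fin; exists s.
by rewrite gt0_muley ?lte_fin // leye_eq.
Qed.

Lemma mulmx_expr_inv (R : realType) d (B : 'M[R]_d) k : B \in unitmx ->
  B ^+ k *m invmx B ^+ k = 1%:M.
Proof.
move=> Bu; rewrite mulmxE -exprMn_comm.
  by rewrite -mulmxE mulmxV // expr1n.
by rewrite /GRing.comm -!mulmxE mulmxV ?mulVmx.
Qed.

Section Convergence.
Variables (R : realType) (d : nat) (M : 'M[int]_d).
Variables (T : trigmx R d d) (Q : trigmx R d (d * d)).
Hypothesis M_neq0 : \det M != 0.
Hypothesis T_cst : forall v a,
  subdiv M T (fun=> v) a = invmx (mxR R M^T) *m v.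
Hypothesis TQ : forall F : 'cV[int]_d -> 'cV[R]_d, bounded_fun F ->
  nabla (subdiv M T F) = subdiv M Q (nabla F).
Variable F : 'cV[int]_d -> 'cV[R]_d.
Hypothesis Fb : bounded_fun F.

Local Notation A := (mxR R M).
Local Notation At := (mxR R M^T).

Let h k := iter k (subdiv M T) F.
Let hb k : bounded_fun (h k) := iter_subdiv_bounded M_neq0 T k Fb.

Definition normalized_iterate k a := At ^+ k *m iter k (subdiv M T) F a.
Local Notation G := normalized_iterate.

(** Controls both the oscillation of the [k]-th normalized iterate between
    neighbours and its distance to the next one. *)
Definition oscillation k :=
  opnorm (At ^+ k) * supnorm (nabla (iter k (subdiv M T) F)).
Local Notation osc := oscillation.

Lemma mxRtr_unit : At \in unitmx.
Proof. by rewrite mxR_tr unitmx_tr mxR_unit. Qed.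

Lemma nabla_iter k :
  nabla (iter k (subdiv M T) F) = iter k (subdiv M Q) (nabla F).
Proof. by elim: k => //= k <-; apply: TQ; apply: hb. Qed.

Lemma oscillation_ge0 k : 0 <= osc k.
Proof. by rewrite mulr_ge0 ?opnorm_ge0 ?supnorm_ge0. Qed.

(** Differences of iterates of [S_T] are iterates of [S_Q]. *)
Lemma oscillation_contract L mu s k :
  linf_opnorm (iter L (subdiv M Q)) = s%:E -> opnorm (At ^+ L) * s <= mu ->
  osc (k + L)%N <= mu * osc k.
Proof.
move=> Ls Lmu; have s0 : 0 <= s by rewrite -lee_fin -Ls linf_opnorm_ge0.
apply: (@le_trans _ _ (opnorm (At ^+ L) * opnorm (At ^+ k) *
    (s * supnorm (nabla (h k))))); last first.
  rewrite mulrACA ler_wpM2r //; exact: oscillation_ge0.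
apply: ler_pM; rewrite ?opnorm_ge0 ?supnorm_ge0 //.
  by rewrite addnC exprD opnormM.
apply: supnorm_le => [|a]; first exact/nabla_bounded/hb.
rewrite nabla_iter addnC iterD -nabla_iter.
apply: supnorm_opnorm => //; last exact/nabla_bounded/hb.
exact: iter_subdiv_scale.
Qed.

Lemma sum_abs_le_norm (b : 'cV[int]_d) :
  \sum_j `|b j 0|%:~R <= d%:R * `|mxR R b| :> R.
Proof.
rewrite -[d in d%:R]card_ord -sumr_const mulr_suml.
apply: ler_sum => j _; rewrite mul1r intr_norm.
by have := coord_le_norm (mxR R b) j; rewrite mxE.
Qed.

Lemma iterate_lipschitz k a b :
  `|G k a - G k b| <= (\sum_j `|(a - b) j 0|%:~R) * osc k.
Proof.
rewrite /G -mulmxBr (le_trans (norm_mulmx_le _ _)) // /osc mulrCA.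
by rewrite ler_wpM2l ?opnorm_ge0 // nabla_lipschitz //; apply: hb.
Qed.

(** As [At S_T] reproduces constants, the value at [a] of the next iterate
    differs from the value at [b0], near [M^-1 a], of the current one by an
    average of differences. *)
Lemma iterate_step K : 0 <= K -> exists2 C, 0 <= C & forall k a b0,
  `|invmx A *m mxR R a - mxR R b0| <= K -> `|G k.+1 a - G k b0| <= C * osc k.
Proof.
move=> K0; have [CT CT0 CTE] := subdiv_bound M_neq0 T.
pose K' := K + \sum_(n <- finsupp T) `|invmx A *m mxR R n|.
have K'0 : 0 <= K' by rewrite addr_ge0 // sumr_ge0.
exists (opnorm At * (CT * (d%:R * K'))).
  by rewrite !mulr_ge0 // ?opnorm_ge0 ?ler0n.
move=> k a b0 ab0.
have -> : G k.+1 a - G k b0 =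
    At ^+ k.+1 *m subdiv M T (fun b => h k b - h k b0) a.
  rewrite subdiv_sub // mulmxBr T_cst; congr (_ - _).
  by rewrite exprSr -mulmxE -mulmxA mulKVmx ?mxRtr_unit.
rewrite (le_trans (norm_mulmx_le _ _)) // /osc.
set D := supnorm _; have D0 : 0 <= D := supnorm_ge0 _.
have subT : `|subdiv M T (fun b => h k b - h k b0) a| <= CT * (d%:R * K' * D).
  apply: CTE => [|b]; first by rewrite !mulr_ge0 // ler0n.
  rewrite mem_pmap => /mapP[n nT /esym/(lattice_coordP M_neq0) e].
  rewrite (le_trans (nabla_lipschitz b b0 (hb k))) //.
  apply: ler_wpM2r => //; rewrite (le_trans (sum_abs_le_norm _)) //.
  apply: ler_wpM2l; first exact: ler0n.
  have -> : mxR R (b - b0) =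
      (invmx A *m mxR R a - mxR R b0) - invmx A *m mxR R n.
    rewrite {1}/mxR map_mxB -/(mxR R b) -[mxR R b](mulKmx (mxR_unit R M_neq0)).
    by rewrite -mxRM -e /mxR map_mxB mulmxBr addrAC.
  rewrite (le_trans (ler_normB _ _)) // lerD //.
  by rewrite (big_rem n) //= lerDl sumr_ge0.
apply: (@le_trans _ _ (opnorm (At ^+ k) * opnorm At * (CT * (d%:R * K' * D)))).
  apply: ler_pM => //; rewrite ?opnorm_ge0 //.
  by rewrite exprSr opnormM.
by rewrite le_eqVlt; apply/orP; left; apply/eqP; ring.
Qed.

Definition floor_col (x : 'cV[R]_d) : 'cV[int]_d := \col_i Num.floor (x i 0).

Lemma floor_col_near (x : 'cV[R]_d) : `|mxR R (floor_col x) - x| <= 1.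
Proof.
apply/normv_leP => // i; rewrite !mxE distrC ger0_norm ?subr_ge0 ?floor_le //.
by have := floor_itv (x i 0); rewrite intrD1 => /andP[_]; lra.
Qed.

Lemma floor_col_mxR a : floor_col (mxR R a) = a.
Proof. by apply/matrixP => i j; rewrite ord1 !mxE intrKfloor. Qed.

Variables (C rho : R).
Hypotheses (C_ge0 : 0 <= C) (rho01 : 0 < rho < 1).
Hypothesis osc_geometric : forall k, osc k <= C * rho ^+ k.

(** The integer points next to [A^k x] and to [A^(k+1) x] correspond up to
    bounded errors, so the increments of the sequence defining the limit are
    of the order of the oscillation. *)
Lemma limit_function : exists B g, 0 <= B /\ forall k x,
  `|G k (floor_col (A ^+ k *m x)) - g x| <= B * rho ^+ k.
Proof.
have [D D0 DE] := iterate_step (addr_ge0 (opnorm_ge0 (invmx A)) ler01).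
have stepE x k : `|G k.+1 (floor_col (A ^+ k.+1 *m x)) -
    G k (floor_col (A ^+ k *m x))| <= D * C * rho ^+ k.
  rewrite -mulrA; apply: le_trans (ler_wpM2l D0 (osc_geometric k)).
  apply: DE; set y := A ^+ k *m x.
  have -> : A ^+ k.+1 *m x = A *m y by rewrite exprS -mulmxE mulmxA.
  have -> : invmx A *m mxR R (floor_col (A *m y)) - mxR R (floor_col y) =
      invmx A *m (mxR R (floor_col (A *m y)) - A *m y) -
      (mxR R (floor_col y) - y).
    by rewrite mulmxBr mulKmx ?mxR_unit // opprB addrA subrK.
  rewrite (le_trans (ler_normB _ _)) // lerD ?floor_col_near //.
  rewrite (le_trans (norm_mulmx_le _ _)) // ler_piMr ?opnorm_ge0 //.
  exact: floor_col_near.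
have /boolp.choice[g gE] x :=
  geometric_limit_col rho01 (mulr_ge0 D0 C_ge0) (stepE x).
exists (D * C / (1 - rho)), g; split=> //.
by case/andP: rho01 => _ /ltW r1; rewrite divr_ge0 ?mulr_ge0 ?subr_ge0.
Qed.

Lemma geometric_small (B e : R) : 0 < e -> exists k, B * rho ^+ k < e.
Proof.
move=> e0; have /andP[r0 r1] := rho01.
have : (fun k => B * rho ^+ k) @ \oo --> (0 : R).
  rewrite -[X in _ --> X](mulr0 B); apply: cvgMr.
  by apply: cvg_expr; rewrite ger0_norm // ltW.
move=> /cvgrPdist_lt /(_ _ e0)[k _ /(_ k (leqnn k))] /=.
by rewrite sub0r normrN => /(le_lt_trans (ler_norm _)); exists k.
Qed.

Lemma normalized_limit_exists : exists g, normalized_limit M T F g.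
Proof.
have [B [g [B0 gE]]] := limit_function; exists g; split; last first.
  apply: (@squeeze_cvge _ _ _ _ (fun=> 0%E) _ (fun k => (B * rho ^+ k)%:E)).
  - near=> k; rewrite linf_norm_ge0; apply/linf_normP => a.
    have := gE k (invmx A ^+ k *m mxR R a).
    by rewrite mulmxA mulmx_expr_inv ?mxR_unit // mul1mx floor_col_mxR.
  - exact: cvg_cst.
  - apply: cvg_EFin; first by near=> k.
    have /andP[r0 r1] := rho01.
    rewrite -[X in _ --> X](mulr0 B); apply: cvgMr.
    by apply: cvg_expr; rewrite ger0_norm // ltW.
suff gx (x : 'cV[R]_d) : g y @[y --> x] --> g x by exact: gx.
apply/(@cvgrPdist_lt _ _ _ (nbhs x)) => e e0.
(* Points that [A^k] maps to distance at most 1 are rounded to points at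
   distance at most 3, which bounds the oscillation; [B + B] accounts for
   replacing the limit by the [k]-th iterate at either point. *)
have [k ke] := geometric_small (B + B + d%:R * 3 * C) e0.
have /andP[r0 _] := rho01.
have rk0 : 0 <= rho ^+ k by rewrite exprn_ge0 // ltW.
have a0 : 0 < opnorm (A ^+ k) + 1 by rewrite ltr_wpDl ?opnorm_ge0.
near=> y; apply: le_lt_trans ke.
pose fx := floor_col (A ^+ k *m x); pose fy := floor_col (A ^+ k *m y).
have xy : `|A ^+ k *m (x - y)| <= 1.
  rewrite (le_trans (norm_mulmx_le _ _)) //.
  have xyd : `|x - y| <= (opnorm (A ^+ k) + 1)^-1.
    near: y; apply: cvgr_dist_le; last by rewrite invr_gt0.
    exact: cvg_id.
  apply: le_trans (ler_wpM2l (opnorm_ge0 _) xyd) _.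
  by rewrite ler_pdivrMr // mul1r lerDl.
have fxy : `|mxR R (fx - fy)| <= 3.
  have -> : mxR R (fx - fy) = (mxR R fx - A ^+ k *m x) -
      (mxR R fy - A ^+ k *m y) + A ^+ k *m (x - y).
    by rewrite /mxR map_mxB mulmxBr; move: (A ^+ k *m x) (A ^+ k *m y) => u v;
      rewrite opprB; apply/matrixP => i j; rewrite !mxE; ring.
  rewrite (le_trans (ler_normD _ _)) // (_ : 3 = 1 + 1 + 1 :> R); last by ring.
  rewrite lerD // (le_trans (ler_normB _ _)) // lerD //; exact: floor_col_near.
have Gxy : `|G k fx - G k fy| <= d%:R * 3 * C * rho ^+ k.
  rewrite (le_trans (iterate_lipschitz _ _ _)) // -mulrA.
  apply: ler_pM => //; first by apply: sumr_ge0 => j _; rewrite ler0z.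
    exact: oscillation_ge0.
  apply: le_trans (sum_abs_le_norm _) _.
  by rewrite ler_wpM2l ?ler0n.
have -> : g x - g y = - (G k fx - g x) + (G k fy - g y) + (G k fx - G k fy).
  by apply/matrixP => i j; rewrite !mxE; ring.
rewrite (le_trans (ler_normD _ _)) // !mulrDl lerD //.
by rewrite (le_trans (ler_normD _ _)) // normrN lerD //; apply: gE.
Unshelve. all: by end_near.
Qed.

End Convergence.

(** * Dilation matrices are expanding *)

Section Expansion.
Import ComplexField.Normc.
Variables (R : realType).
Local Notation toC := (real_complex R).

Lemma normcE (z : R[i]) : `|z| = (normc z)%:C%C.
Proof. by []. Qed.

Lemma normc_ge0 (z : R[i]) : 0 <= normc z.
Proof. by case: z => a b; apply: sqrtr_ge0. Qed.

Lemma normc_add_le (x y : R[i]) : normc (x + y) <= normc x + normc y.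
Proof. by rewrite -lecR rmorphD /=; apply: (@ler_normD _ R[i]). Qed.

(** With [r] the modulus of [z], the rate [rho + r - rho r] is at least [rho]
    and exceeds [r], but is below 1; the margin over [r] absorbs [y], also
    when [rho = r], where a factor polynomial in [k] appears. *)
Lemma recurrence_decay (n : nat) (w y : nat -> 'cV[R[i]]_n) (z : R[i]) (C rho : R) :
  normc z < 1 -> 0 <= C -> 0 < rho < 1 ->
  (forall k, w k.+1 = z *: w k + y k) ->
  (forall k i, normc (y k i 0) <= C * rho ^+ k) ->
  exists C' rho', [/\ 0 <= C', 0 < rho' < 1 &
    forall k i, normc (w k i 0) <= C' * rho' ^+ k].
Proof.
move=> z1 C0 /andP[r0 r1] wE yC; have z0 := normc_ge0 z.
pose W := \sum_i normc (w 0%N i 0).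
have W0 : 0 <= W by apply: sumr_ge0 => i _; apply: normc_ge0.
pose g := rho * (1 - normc z).
have g0 : 0 < g by rewrite mulr_gt0 ?subr_gt0.
pose rho' := normc z + g; pose C' := W + C / g.
have Cg : 0 <= C / g by rewrite divr_ge0 // ltW.
have C'0 : 0 <= C' by rewrite addr_ge0.
have rr' : rho <= rho' by rewrite /rho' /g; nra.
have r'1 : rho' < 1 by rewrite /rho' /g; nra.
have r'0 : 0 < rho' by rewrite ltr_wpDl.
exists C', rho'; split=> //; first exact/andP.
elim=> [|k IHk] i.
  rewrite expr0 mulr1 /C'; apply: (@le_trans _ _ W); last by rewrite lerDl.
  by rewrite /W (bigD1 i) //= lerDl sumr_ge0 // => j _; apply: normc_ge0.
rewrite wE !mxE (le_trans (normc_add_le _ _)) // normcM.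
have rk : rho ^+ k <= rho' ^+ k by apply: lerXn2r; rewrite ?nnegrE // ltW.
have CC' : C <= C' * g.
  by rewrite /C' mulrDl divfK ?gt_eqF // lerDr mulr_ge0 // ltW.
have yk : normc (y k i 0) <= C' * g * rho' ^+ k.
  apply: le_trans (yC k i) _; apply: ler_pM => //.
  by rewrite exprn_ge0 // ltW.
apply: le_trans (lerD (ler_wpM2l z0 (IHk i)) yk) _.
by rewrite exprS /rho' le_eqVlt; apply/orP; left; apply/eqP; ring.
Qed.

Variable n : nat.

(** Each linear factor of the annihilating polynomial gives a recurrence of
    order one, whose source term is annihilated by the other factors. *)
Lemma annihilated_decay (B : 'M[R[i]]_n.+1) (s : seq R[i]) (x : 'cV[R[i]]_n.+1) :
  {in s, forall z, normc z < 1} ->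
  horner_mx B (\prod_(z <- s) ('X - z%:P)) *m x = 0 ->
  exists C rho, [/\ 0 <= C, 0 < rho < 1 &
    forall k i, normc ((B ^+ k *m x) i 0) <= C * rho ^+ k].
Proof.
elim: s x => [|z s IHs] x s1.
  rewrite big_nil rmorph1 mul1mx => ->; exists 0, 2^-1; split=> //.
    by rewrite invr_gt0 ltr0n invf_lt1 ?ltr1n // ltr0n.
  by move=> k i; rewrite mulmx0 mxE normc0 mul0r.
rewrite big_cons mulrC rmorphM /= rmorphB /= horner_mx_X horner_mx_C.
rewrite -mulmxE -mulmxA => /IHs [u us|C [rho [C0 rho01 yC]]].
  by apply: s1; rewrite inE us orbT.
apply: (@recurrence_decay _ _ (fun k => B ^+ k *m ((B - z%:M) *m x)) z C rho) => //.
  by apply: s1; rewrite mem_head.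
move=> k; rewrite mulmxBl mulmxBr mul_scalar_mx -scalemxAr addrC subrK.
by rewrite exprSr -mulmxE mulmxA.
Qed.

(** By Cayley-Hamilton the powers of a matrix satisfy a linear recurrence
    whose roots are its eigenvalues. *)
Lemma eigenvalue_decay (B : 'M[R[i]]_n.+1) (x : 'cV[R[i]]_n.+1) :
  (forall z, eigenvalue B z -> normc z < 1) ->
  exists C rho, [/\ 0 <= C, 0 < rho < 1 &
    forall k i, normc ((B ^+ k *m x) i 0) <= C * rho ^+ k].
Proof.
move=> B1; have [s sE] := closed_field_poly_normal (char_poly B).
rewrite (monicP (char_poly_monic B)) scale1r in sE.
apply: (@annihilated_decay B s); last by rewrite -sE Cayley_Hamilton mul0mx.
by move=> z zs; apply: B1; rewrite eigenvalue_root_char sE root_prod_XsubC.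
Qed.

Variable M : 'M[int]_n.+1.
Hypothesis M_dilation : dilation R M.
Local Notation A := (mxR R M).

Lemma dilation_inverse_eigenvalue z :
  eigenvalue (map_mx toC (invmx A)) z -> normc z < 1.
Proof.
case: M_dilation => M0 M1 /eigenvalueP[v vz v0].
have [->|z0] := eqVneq z 0; first by rewrite normc0.
have AC : map_mx toC A = map_mx intr M.
  by apply/matrixP => i j; rewrite !mxE rmorph_int.
have /M1 : eigenvalue (map_mx intr M : 'M[R[i]]_n.+1) z^-1.
  apply/eigenvalueP; exists v => //; rewrite -AC.
  apply: (scalerI z0); rewrite scalerA divff // scale1r scalemxAl -vz.
  by rewrite -mulmxA -map_mxM mulVmx ?mxR_unit // map_mx1 mulmx1.
rewrite normcE normcV -[1]/(1%:C)%C ltcR.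
have nz : 0 < normc z.
  by rewrite lt_neqAle normc_ge0 andbT eq_sym; apply: contra z0 => /eqP/eq0_normc ->.
by rewrite -[X in X < _ -> _]invr1 ltf_pV2 // posrE ?ltr01.
Qed.

Lemma inverse_power_decay : exists C rho, [/\ 0 <= C, 0 < rho < 1 &
  forall k (x : 'cV[R]_n.+1), `|invmx A ^+ k *m x| <= C * rho ^+ k * `|x|].
Proof.
have /boolp.choice[Cr CrE] (j : 'I_n.+1) : exists Cr : R * R,
    [/\ 0 <= Cr.1, 0 < Cr.2 < 1 &
    forall k i, `|(invmx A ^+ k) i j| <= Cr.1 * Cr.2 ^+ k].
  have [C [rho [C0 rho01 CE]]] :=
    eigenvalue_decay (delta_mx j 0) dilation_inverse_eigenvalue.
  exists (C, rho); split=> // k i; have := CE k i.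
  rewrite -rmorphXn -colE !mxE; move: (_ i j) => u.
  by rewrite /normc /= expr0n addr0 sqrtr_sqr.
pose rho := \big[Num.max/2^-1]_j (Cr j).2.
have rhoj j : (Cr j).2 <= rho by apply: le_bigmax.
have rho0 : 0 < rho.
  by apply: lt_le_trans (rhoj ord0); case: (CrE ord0) => _ /andP[].
have rho1 : rho < 1.
  apply: bigmax_lt => [|j _]; first by rewrite invf_lt1 ?ltr1n // ltr0n.
  by case: (CrE j) => _ /andP[].
have C0 j : 0 <= (Cr j).1 by case: (CrE j).
exists (\sum_j (Cr j).1), rho; split; [exact: sumr_ge0|exact/andP|].
move=> k x; have rk : 0 <= rho ^+ k by rewrite exprn_ge0 // ltW.
apply/normv_leP => [|i]; first by rewrite !mulr_ge0 // sumr_ge0.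
rewrite mxE (le_trans (ler_norm_sum _ _ _)) // !mulr_suml.
apply: ler_sum => j _; rewrite normrM ler_pM // ?coord_le_norm //.
have [_ /andP[r0 _] CE] := CrE j; apply: le_trans (CE k i) _.
apply: ler_wpM2l => //; apply: lerXn2r; rewrite ?nnegrE //; exact: ltW.
Qed.

End Expansion.

Lemma dilation_inverse_decay (R : realType) d (M : 'M[int]_d) :
  (0 < d)%N -> dilation R M -> exists C rho, [/\ 0 <= C, 0 < rho < 1 &
  forall k (x : 'cV[R]_d), `|invmx (mxR R M) ^+ k *m x| <= C * rho ^+ k * `|x|].
Proof. by case: d M => // n M _; apply: inverse_power_decay. Qed.

(** * A nonzero limit *)

Section NonzeroLimit.
Variables (R : realType) (d : nat) (M : 'M[int]_d) (T : trigmx R d d).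
Hypothesis M_neq0 : \det M != 0.
Hypothesis T_cst : forall v a,
  subdiv M T (fun=> v) a = invmx (mxR R M^T) *m v.

Local Notation A := (mxR R M).
Local Notation At := (mxR R M^T).

Variables (C rho : R).
Hypotheses (C_ge0 : 0 <= C) (rho01 : 0 < rho < 1).
Hypothesis A_expanding : forall k (x : 'cV[R]_d),
  `|invmx A ^+ k *m x| <= C * rho ^+ k * `|x|.

Let r := \sum_(n <- finsupp T) `|mxR R n|.
(* The solution of [radius = rho (radius + C r)]. *)
Let radius := C * r * rho / (1 - rho).

(** A bounded set such that the values there of an iterate only involve the
    values there of the previous one: a ball for the norm
    [sup_j rho^-j |M^-j x|], which [M^-1] contracts by [rho]. *)
Definition absorbing (b : 'cV[int]_d) : Prop :=
  forall j, `|invmx A ^+ j *m mxR R b| <= radius * rho ^+ j.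

Lemma radius_ge0 : 0 <= radius.
Proof.
have /andP[r0 r1] := rho01.
by rewrite divr_ge0 ?subr_ge0 ?mulr_ge0 ?sumr_ge0 // ltW.
Qed.

Lemma absorbing0 : absorbing 0.
Proof.
move=> j; rewrite /mxR map_mx0 mulmx0 normr0 mulr_ge0 ?radius_ge0 //.
by have /andP[/ltW r0 _] := rho01; rewrite exprn_ge0.
Qed.

Lemma absorbing_arguments a b :
  absorbing a -> b \in arguments M (finsupp T) a -> absorbing b.
Proof.
move=> Ka; rewrite mem_pmap => /mapP[n nT /esym/(lattice_coordP M_neq0) e] j.
have /andP[r0 r1] := rho01.
have bE : mxR R b = invmx A *m mxR R a - invmx A *m mxR R n.
  rewrite -[mxR R b](mulKmx (mxR_unit R M_neq0)) -mxRM -e.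
  by rewrite /mxR map_mxB mulmxBr.
rewrite bE mulmxBr !mulmxA [_ ^+ j *m _](_ : _ = invmx A ^+ j.+1); last first.
  by rewrite exprSr mulmxE.
apply: le_trans (ler_normB _ _) _.
have nr : `|mxR R n| <= r.
  by rewrite /r (big_rem n) //= lerDl sumr_ge0.
have rj : 0 <= rho ^+ j.+1 by rewrite exprn_ge0 // ltW.
have An : `|invmx A ^+ j.+1 *m mxR R n| <= C * rho ^+ j.+1 * r.
  by apply: le_trans (A_expanding _ _) _; apply: ler_wpM2l; rewrite ?mulr_ge0.
apply: le_trans (lerD (Ka j.+1) An) _.
have rho_neq1 : 1 - rho != 0 by rewrite subr_eq0 gt_eqF.
rewrite /radius exprS le_eqVlt; apply/orP; left; apply/eqP.
by move: (rho ^+ j) => z; field.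
Qed.

(** The margin of 1 covers the neighbours of the points of [absorbing]. *)
Definition truncated_linear (v : 'cV[R]_d) (n : 'cV[int]_d) : R :=
  if `|mxR R n| <= radius + 1 then dotv n v else 0.

Lemma truncated_linear_bounded v : bounded_fun (truncated_linear v).
Proof.
have R1 : 0 <= radius + 1 by rewrite addr_ge0 ?radius_ge0.
apply/(bounded_funE 0); exists (\sum_j (radius + 1) * `|v j 0|) => n.
rewrite /truncated_linear; case: ifPn => [nK|_]; last first.
  by rewrite normr0 sumr_ge0 // => j _; rewrite mulr_ge0.
rewrite (le_trans (ler_norm_sum _ _ _)) //; apply: ler_sum => j _.
rewrite normrM ler_wpM2r //; apply: le_trans nK.
by have := coord_le_norm (mxR R n) j; rewrite mxE.
Qed.

Lemma nabla1_truncated_linear v b : absorbing b ->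
  nabla1 (truncated_linear v) b = v.
Proof.
move=> /(_ 0%N); rewrite !expr0 mul1mx mulr1 => bK.
apply/matrixP => j o; rewrite ord1 mxE /truncated_linear.
rewrite (le_trans bK) ?lerDl // ifT ?dotv_diff //.
rewrite /mxR map_mxB (le_trans (ler_normB _ _)) // lerD //.
apply/normv_leP => // i; rewrite !mxE.
by case: (_ && _); rewrite ?normr1 ?normr0.
Qed.

Lemma iterate_truncated_linear v k a : absorbing a ->
  iter k (subdiv M T) (nabla1 (truncated_linear v)) a = invmx At ^+ k *m v.
Proof.
elim: k a => [|k IHk] a Ka.
  by rewrite expr0 mul1mx; apply: nabla1_truncated_linear.
rewrite iterS (@subdiv_local _ _ _ M_neq0 _ _ _ (fun=> invmx At ^+ k *m v)).
  by rewrite T_cst mulmxA mulmxE -exprS.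
by move=> b /(absorbing_arguments Ka) Kb; apply: IHk.
Qed.

Lemma limit_truncated_linear v g :
  normalized_limit M T (nabla1 (truncated_linear v)) g -> g 0 = v.
Proof.
move=> [_ gl]; apply/eqP; rewrite eq_sym -subr_eq0 -normr_eq0; apply/eqP.
suff : `|v - g 0|%:E = 0%E by case.
apply: (@cvg_unique _ (@ereal_hausdorff R)
  ((fun=> `|v - g 0|%:E : \bar R) @ \oo)); first exact: cvg_cst.
apply: (@squeeze_cvge _ _ _ _ (fun=> 0%E)) gl; last exact: cvg_cst.
near=> k; rewrite lee_fin normr_ge0 /=.
apply: ereal_sup_ubound; exists 0 => //=.
rewrite iterate_truncated_linear; last exact: absorbing0.
rewrite mulmxA mulmx_expr_inv ?mxRtr_unit // mul1mx.
by rewrite [mxR R 0](_ : _ = 0) ?mulmx0 // /mxR map_mx0.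
Unshelve. all: by end_near.
Qed.

End NonzeroLimit.

Lemma nabla_linf_subspace (R : realType) (d : nat) : linf_subspace (@nabla_linf R d).
Proof.
split.
- by move=> _ [f /= fb <-]; apply: nabla1_bounded.
- exists (fun=> 0).
    by apply/(bounded_funE 0); exists 0 => a; rewrite normr0.
  by apply/funext => a; apply/matrixP => i j; rewrite !mxE subr0.
- move=> c _ _ [f /(bounded_funE 0)[B fB] <-] [g /(bounded_funE 0)[B' gB'] <-].
  exists (fun a => c * f a + g a).
    apply/(bounded_funE 0); exists (`|c| * B + B') => a.
    rewrite (le_trans (ler_normD _ _)) // lerD // normrM.
    by rewrite ler_wpM2l.
  by apply/funext => a; apply/matrixP => i j; rewrite !mxE; ring.
Qed.

Theorem theorem17 (R : realType) (d : nat) (M : 'M[int]_d)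
    (D : set 'cV[int]_d) (t : trigpoly R d)
    (d_gt0 : (0 < d)%N) (hM : dilation R M) (hD : coset_reps M^T D)
    (ht : in_Z 1 M D t) :
  (exists (T : trigmx R d d) (Q : trigmx R d (d * d)),
     nabla_intertwined M t T Q) /\
  (trigpoly_eval t 0 = (`|\det M|%N)%:R ->
   forall (T : trigmx R d d) (Q : trigmx R d (d * d)),
     nabla_intertwined M t T Q ->
   forall (L : nat) (mu : R), (0 < L)%N -> mu < 1 ->
     (mx_opnorm ((mxR R M^T) ^+ L) * linf_opnorm (iter L (subdiv M Q))
        <= mu%:E)%E ->
   normalized_uniformly_converges M T (@nabla_linf R d)).
Proof.
have M0 := hM.1.
have [c rule0] := in_Z_sum_rule0 M0 hD ht.
have rule1 := in_Z_sum_rule1 M0 hD ht.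
split; first exact: intertwined_exists rule0 rule1.
move=> t0 T Q [tT TQ] L mu L0 mu1 Lmu.
have c1 : c = 1.
  have := sum_coefs_cosets M0 rule0.
  have -> : \sum_(n <- finsupp t) t n = `|\det M|%N%:R.
    apply: (@complexI R); rewrite rmorph_nat -t0 rmorph_sum.
    apply: eq_bigr => n _; rewrite dotvE mulmx0 mxE mulr0 oppr0 expi0.
    by rewrite mulr1.
  move=> /esym/eqP; rewrite -[X in _ == X]mulr1.
  by rewrite (inj_eq (mulfI _)) ?pnatr_eq0 ?absz_eq0 // => /eqP.
have T_cst v a : subdiv M T (fun=> v) a = invmx (mxR R M^T) *m v.
  by rewrite (subdiv_cst M0 rule0 rule1) // c1 scale1r.
have AtL : (mxR R M^T) ^+ L \in unitmx.
  elim: (L) => [|k IHk]; first by rewrite expr0 unitmx1.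
  by rewrite exprS -mulmxE unitmx_mul mxRtr_unit.
have [s [Ls Lsmu]] := contraction_factor d_gt0 AtL Lmu.
have lim f : bounded_fun f -> exists g, normalized_limit M T (nabla1 f) g.
  move=> /nabla1_bounded fb.
  have [C [rho [C0 rho01 oscE]]] := geometric_decay L0 mu1
    (oscillation_ge0 M T (nabla1 f))
    (fun k => oscillation_contract M0 TQ fb k Ls Lsmu).
  exact: (normalized_limit_exists M0 T_cst fb C0 rho01 oscE).
have [C [rho [C0 rho01 AC]]] := dilation_inverse_decay d_gt0 hM.
pose v : 'cV[R]_d := const_mx 1.
have v0 : v != 0.
  apply/eqP => /matrixP /(_ (Ordinal d_gt0) 0) /eqP; rewrite !mxE; apply/negP.
  exact: oner_neq0.
pose f := truncated_linear T C rho v.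
have fb : bounded_fun f by apply: truncated_linear_bounded.
have [g fg] := lim f fb.
split.
- exact: nabla_linf_subspace.
- move=> V0; have : (@nabla_linf R d) (nabla1 f) by exists f.
  rewrite V0 => /(congr1 (fun F => F 0)).
  rewrite (nabla1_truncated_linear v (absorbing0 M T C0 rho01)).
  by move/eqP; apply/negP.
- by move=> _ [h hb <-]; apply: lim.
- exists (nabla1 f), g; split=> //; first by exists f.
  by exists 0; rewrite (limit_truncated_linear M0 T_cst C0 rho01 AC fg).
Qed.
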